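(* In $\mathbf{ZF}$: a countable product of one-point Hausdorff compactifications of denumerable discrete spaces is first-countable if and only if it is metrizable, and it is first-countable if and only if it is quasi-metrizable.
   Context: The theory is $\mathbf{ZF}$ (no choice). A set is denumerable if it is equipotent with $\omega$. A countable product is a Tychonoff product $\prod_{j\in J}\mathbf{Y}_j$ indexed by a (non-empty) countable set $J$. The one-point Hausdorff compactification of an infinite discrete space $X$ is $X\cup\{\infty\}$ ($\infty\notin X$), where all subsets of $X$ are open and a set containing $\infty$ is open iff its complement is finite. A quasi-metric on $X$ is $d:X\times X\to[0,+\infty)$ with $d(x,x)=0$, $d(x,y)\le d(x,z)+d(z,y)$, and $d(x,y)=0\Rightarrow x=y$; its topology $\tau(d)$ consists of all $V\subseteq X$ such that for every $x\in V$ there is $n\in\omega$ with $\{y: d(x,y)<2^{-n}\}\subseteq V$. A space is quasi-metrizable if its topology equals $\tau(d)$ for some quasi-metric $d$. *)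

(* Defs.v *)
(** First-order ZF is presented through its models.  Schemas range over
    formulas with parameters, never over arbitrary Rocq predicates: with the
    latter, a choice principle of the metatheory would make the axiom of
    choice true in every model. *)

Set Implicit Arguments.
Unset Strict Implicit.

Record structure := Structure {
  carrier :> Type;
  mem : carrier -> carrier -> Prop
}.

Notation "x ∈ y" := (mem x y) (at level 70).
Notation "x ∉ y" := (~ mem x y) (at level 70).

(** Variables are de Bruijn indices. *)
Inductive formula :=
| FMem (i j : nat)
| FEq (i j : nat)
| FFalse
| FImp (f g : formula)
| FAnd (f g : formula)
| FOr (f g : formula)
| FAll (f : formula)
| FEx (f : formula).

Definition scons {T : Type} (x : T) (e : nat -> T) (n : nat) : T :=
  match n with O => x | S m => e m end.

Fixpoint sat (V : structure) (e : nat -> V) (f : formula) : Prop :=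
  match f with
  | FMem i j => e i ∈ e j
  | FEq i j => e i = e j
  | FFalse => False
  | FImp g h => sat e g -> sat e h
  | FAnd g h => sat e g /\ sat e h
  | FOr g h => sat e g \/ sat e h
  | FAll g => forall x : V, sat (scons x e) g
  | FEx g => exists x : V, sat (scons x e) g
  end.

(** The predicates of this section and of the section [Topology] quantify over
    elements of [V] only, so each of them unfolds to a first-order formula in
    membership and equality. *)

Section SetTheory.
Context {V : structure}.
Implicit Types a b c f p s t w x y z : V.

Definition subset a b := forall z, z ∈ a -> z ∈ b.
Definition is_empty a := forall z, z ∉ a.
Definition is_upair p a b := forall z, z ∈ p <-> z = a \/ z = b.
Definition is_union u a := forall z, z ∈ u <-> exists y, y ∈ a /\ z ∈ y.
Definition is_power q a := forall z, z ∈ q <-> subset z a.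
Definition is_succ s n := forall z, z ∈ s <-> z ∈ n \/ z = n.
Definition is_diff d a b := forall z, z ∈ d <-> z ∈ a /\ z ∉ b.

Definition inductive_set a :=
  (exists e, is_empty e /\ e ∈ a) /\
  (forall n, n ∈ a -> exists s, is_succ s n /\ s ∈ a).

Definition is_omega w :=
  inductive_set w /\ forall a, inductive_set a -> subset w a.

(** Kuratowski pair [p = {{a}, {a, b}}]. *)
Definition is_opair p a b :=
  exists s t, is_upair s a a /\ is_upair t a b /\ is_upair p s t.

Definition is_cart p a b :=
  forall z, z ∈ p <-> exists x y, x ∈ a /\ y ∈ b /\ is_opair z x y.

(** [app f x y] is [(x, y) ∈ f]; it is used both for functions ([f(x) = y])
    and for relations, and [app2 f x y z] for [((x, y), z) ∈ f]. *)
Definition app f x y := exists p, is_opair p x y /\ p ∈ f.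
Definition app2 f x y z := exists p, is_opair p x y /\ app f p z.

Definition is_family f a :=
  (forall p, p ∈ f -> exists x y, x ∈ a /\ is_opair p x y) /\
  (forall x, x ∈ a -> exists! y, app f x y).

Definition is_fun f a b :=
  is_family f a /\ forall x y, app f x y -> y ∈ b.

Definition is_bijection f a b :=
  is_fun f a b /\ forall y, y ∈ b -> exists! x, app f x y.

Definition equipotent a b := exists f, is_bijection f a b.

Definition finite_set a := exists w n, is_omega w /\ n ∈ w /\ equipotent a n.
Definition denumerable a := exists w, is_omega w /\ equipotent a w.
Definition countable_set a :=
  exists w b, is_omega w /\ subset b w /\ equipotent a b.

(** [P] is the Cartesian product of the family [Y] indexed by [J]. *)
Definition is_product (P J Y : V) :=
  forall f, f ∈ P <->
    is_family f J /\
    forall j x y, app f j x -> app Y j y -> x ∈ y.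

End SetTheory.

Record ZF (V : structure) : Prop := {
  extensionality : forall a b : V, (forall z : V, z ∈ a <-> z ∈ b) -> a = b;
  foundation : forall a : V, (exists x : V, x ∈ a) ->
    exists x : V, x ∈ a /\ forall z : V, z ∈ x -> z ∉ a;
  pairing : forall a b : V, exists p : V, is_upair p a b;
  union : forall a : V, exists u : V, is_union u a;
  power_set : forall a : V, exists q : V, is_power q a;
  infinity : exists a : V, inductive_set a;
  separation : forall (phi : formula) (e : nat -> V) (a : V),
    exists b : V, forall z : V, z ∈ b <-> z ∈ a /\ sat (scons z e) phi;
  replacement : forall (phi : formula) (e : nat -> V) (a : V),
    (forall x y y' : V, x ∈ a ->
       sat (scons x (scons y e)) phi -> sat (scons x (scons y' e)) phi ->
       y = y') ->
    exists b : V, forall y : V,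
      y ∈ b <-> exists x : V, x ∈ a /\ sat (scons x (scons y e)) phi
}.

(** The real line inside a model: a complete ordered field all of whose
    operations are elements of the model, completeness being asserted for the
    subsets that belong to the model.  In ZF such a field exists and is unique
    up to a unique isomorphism. *)
Record real_line (V : structure) := RealLine {
  Rset : V; Radd : V; Rmul : V; Rle : V; Rzero : V; Rone : V;
  Rzero_in : Rzero ∈ Rset;
  Rone_in : Rone ∈ Rset;
  Radd_fun : exists RR : V, is_cart RR Rset Rset /\ is_fun Radd RR Rset;
  Rmul_fun : exists RR : V, is_cart RR Rset Rset /\ is_fun Rmul RR Rset;
  Rle_rel : exists RR : V, is_cart RR Rset Rset /\ subset Rle RR;
  Radd_comm : forall x y z : V, app2 Radd x y z -> app2 Radd y x z;
  Radd_assoc : forall x y z xy yz s : V,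
    app2 Radd x y xy -> app2 Radd y z yz ->
    app2 Radd xy z s -> app2 Radd x yz s;
  Radd_zero : forall x : V, x ∈ Rset -> app2 Radd x Rzero x;
  Radd_opp : forall x : V, x ∈ Rset ->
    exists y : V, y ∈ Rset /\ app2 Radd x y Rzero;
  Rmul_comm : forall x y z : V, app2 Rmul x y z -> app2 Rmul y x z;
  Rmul_assoc : forall x y z xy yz s : V,
    app2 Rmul x y xy -> app2 Rmul y z yz ->
    app2 Rmul xy z s -> app2 Rmul x yz s;
  Rmul_one : forall x : V, x ∈ Rset -> app2 Rmul x Rone x;
  Rmul_inv : forall x : V, x ∈ Rset -> x <> Rzero ->
    exists y : V, y ∈ Rset /\ app2 Rmul x y Rone;
  Rone_neq_zero : Rone <> Rzero;
  Rdistr : forall x y z yz xy xz s : V,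
    app2 Radd y z yz -> app2 Rmul x y xy -> app2 Rmul x z xz ->
    app2 Rmul x yz s -> app2 Radd xy xz s;
  Rle_refl : forall x : V, x ∈ Rset -> app Rle x x;
  Rle_antisym : forall x y : V, app Rle x y -> app Rle y x -> x = y;
  Rle_trans : forall x y z : V, app Rle x y -> app Rle y z -> app Rle x z;
  Rle_total : forall x y : V, x ∈ Rset -> y ∈ Rset ->
    app Rle x y \/ app Rle y x;
  Rle_add : forall x y z xz yz : V,
    app Rle x y -> app2 Radd x z xz -> app2 Radd y z yz -> app Rle xz yz;
  Rle_mul : forall x y z : V,
    app Rle Rzero x -> app Rle Rzero y -> app2 Rmul x y z -> app Rle Rzero z;
  Rcomplete : forall S : V,
    subset S Rset -> (exists x : V, x ∈ S) ->
    (exists u : V, u ∈ Rset /\ forall x : V, x ∈ S -> app Rle x u) ->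
    exists m : V, m ∈ Rset /\ (forall x : V, x ∈ S -> app Rle x m) /\
      forall u : V, u ∈ Rset -> (forall x : V, x ∈ S -> app Rle x u) ->
        app Rle m u
}.

Section Topology.
Context {V : structure}.

(** A topological space is given by its set of points and its set of open
    sets. *)

(** [(Y, T)] is the one-point Hausdorff compactification of the discrete
    space [X], for some choice of the point at infinity. *)
Definition is_one_point_compactification (X Y T : V) :=
  exists oo : V, oo ∉ X /\
    (forall z : V, z ∈ Y <-> z ∈ X \/ z = oo) /\
    (forall U : V, U ∈ T <->
       subset U Y /\
       (oo ∈ U -> exists C : V, is_diff C Y U /\ finite_set C)).

(** [Y] and [T] are the families of carriers and of topologies; [B] is a box
    [∏ U_j] with [U_j] open for all [j] and [U_j = Y_j] off a finite set. *)
Definition is_basic_open (J Y T B : V) :=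
  exists U F : V,
    is_family U J /\
    (forall j u t : V, app U j u -> app T j t -> u ∈ t) /\
    finite_set F /\ subset F J /\
    (forall j u y : V, j ∉ F -> app U j u -> app Y j y -> u = y) /\
    is_product B J U.

Definition is_product_topology (J Y T P TP : V) :=
  forall W : V, W ∈ TP <->
    subset W P /\
    forall f : V, f ∈ W ->
      exists B : V, is_basic_open J Y T B /\ f ∈ B /\ subset B W.

Definition first_countable (X T : V) :=
  forall x : V, x ∈ X ->
    exists B : V, countable_set B /\ subset B T /\
      (forall U : V, U ∈ B -> x ∈ U) /\
      (forall W : V, W ∈ T -> x ∈ W -> exists U : V, U ∈ B /\ subset U W).

Variable R : real_line V.

Definition Rlt (x y : V) := app (Rle R) x y /\ x <> y.

(** [r = 2^-n], through the recursion [h(0) = 1], [h(n+1) + h(n+1) = h(n)]. *)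
Definition is_half_power (n r : V) :=
  exists w h : V, is_omega w /\ is_fun h w (Rset R) /\
    (forall z : V, is_empty z -> app h z (Rone R)) /\
    (forall k sk x y : V, is_succ sk k -> app h k x -> app h sk y ->
       app2 (Radd R) y y x) /\
    app h n r.

Definition is_quasi_metric (d X : V) :=
  (exists XX : V, is_cart XX X X /\ is_fun d XX (Rset R)) /\
  (forall x y r : V, app2 d x y r -> app (Rle R) (Rzero R) r) /\
  (forall x : V, x ∈ X -> app2 d x x (Rzero R)) /\
  (forall x y z a b c s : V,
     app2 d x y a -> app2 d x z b -> app2 d z y c -> app2 (Radd R) b c s ->
     app (Rle R) a s) /\
  (forall x y : V, app2 d x y (Rzero R) -> x = y).

Definition is_metric (d X : V) :=
  is_quasi_metric d X /\ forall x y r : V, app2 d x y r -> app2 d y x r.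

(** [T] is the topology [τ(d)] on [X]. *)
Definition is_induced_topology (d X T : V) :=
  forall W : V, W ∈ T <->
    subset W X /\
    forall x : V, x ∈ W ->
      exists w n e : V, is_omega w /\ n ∈ w /\ is_half_power n e /\
        forall y r : V, app2 d x y r -> Rlt r e -> y ∈ W.

Definition quasi_metrizable (X T : V) :=
  exists d : V, is_quasi_metric d X /\ is_induced_topology d X T.

Definition metrizable (X T : V) :=
  exists d : V, is_metric d X /\ is_induced_topology d X T.

End Topology.

(* Main.v *)
(** At the point whose coordinates are all at infinity, a countable base
    [(U_k)] determines traces [pi_j(U_k)], which are cofinite in the [j]-th
    factor, uniformly in [j].  Call two points [n]-close when, in each of the
    first [n] factors, they are equal or both lie in the first [n] traces.
    These are decreasing equivalence relations with open classes; they separate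
    points and their classes form a base.  Hence
    [d(f, g) = 2^-min {n : f, g not n-close}] is a metric, and no choice of
    enumerations of the factors is involved.  Conversely, in a quasi-metric
    space the interiors of the balls of radius [2^-n] around a point form a
    countable base there. *)

(* The obstacle is that, although every factor is denumerable, bijections of the factors with [ω]
   cannot be picked for all factors at once, so the usual weighted sum of metrics on the factors
   cannot be formed. Everything must be defined from finitely many sets: the injections of the index
   set and of one base into [ω], and the point whose coordinates are at infinity. That point exists
   without choice because the point at infinity of an infinite factor is determined by its topology,
   so replacement collects these points into a family.

   Separation, replacement and induction on [ω] are available for formulas only. Hence each
   predicate that forms a set or is proved by induction comes with a proof that it is definable with
   parameters, and relations take the place of functions of the metatheory. *)
Require Import Defs.
From Stdlib Require Import Classical.

Set Implicit Arguments.
Unset Strict Implicit.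

(** * Definability with parameters *)

Fixpoint rename (r : nat -> nat) (phi : formula) : formula :=
  let up n := match n with O => O | S m => S (r m) end in
  match phi with
  | FMem i j => FMem (r i) (r j)
  | FEq i j => FEq (r i) (r j)
  | FFalse => FFalse
  | FImp f g => FImp (rename r f) (rename r g)
  | FAnd f g => FAnd (rename r f) (rename r g)
  | FOr f g => FOr (rename r f) (rename r g)
  | FAll f => FAll (rename up f)
  | FEx f => FEx (rename up f)
  end.

Lemma sat_rename (V : structure) (phi : formula) (r : nat -> nat)
  (e e' : nat -> V) (H : forall n, e' n = e (r n)) :
  sat e' phi <-> sat e (rename r phi).
Proof.
  revert r e e' H; induction phi; intros r e e' H; simpl;
    try (rewrite !H; tauto);
    try (rewrite (IHphi1 r e e' H), (IHphi2 r e e' H); tauto); try tauto.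
  - split; intros H1 x; specialize (H1 x); revert H1; apply IHphi;
      intros [|n]; simpl; auto.
  - split; intros [x H1]; exists x; revert H1; apply IHphi;
      intros [|n]; simpl; auto.
Qed.

Fixpoint interleave {A : Type} (a b : nat -> A) (n : nat) : A :=
  match n with
  | O => a O
  | S O => b O
  | S (S m) => interleave (fun k => a (S k)) (fun k => b (S k)) m
  end.

Fixpoint double (n : nat) : nat :=
  match n with O => O | S m => S (S (double m)) end.

Lemma interleave_even (A : Type) (n : nat) (a b : nat -> A) :
  interleave a b (double n) = a n.
Proof. revert a b; induction n; intros; simpl; auto; rewrite IHn; auto. Qed.

Lemma interleave_odd (A : Type) (n : nat) (a b : nat -> A) :
  interleave a b (S (double n)) = b n.
Proof.
  revert a b; induction n; intros a b; auto.
  exact (IHn (fun k => a (S k)) (fun k => b (S k))).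
Qed.

Lemma interleave_map (A B : Type) (f : A -> B) (a b : nat -> A) (c d : nat -> B)
  (Ha : forall n, c n = f (a n)) (Hb : forall n, d n = f (b n)) (n : nat) :
  interleave c d n = f (interleave a b n).
Proof.
  (* [interleave] recurses in steps of two, so the induction carries the claim for two consecutive
     positions. *)
  enough (H : forall m a b c d, (forall n, c n = f (a n)) ->
            (forall n, d n = f (b n)) ->
            interleave c d m = f (interleave a b m) /\
            interleave c d (S m) = f (interleave a b (S m))) by (apply H; auto).
  clear; induction m; intros a b c d Ha Hb.
  - simpl; auto.
  - split; [apply IHm; auto|].
    simpl. apply (IHm (fun k => a (S k)) (fun k => b (S k))); auto.
Qed.

(** The even variables of [phi] are read in the environment, the odd ones are
    parameters; the premise [V] only serves to supply unused parameters. *)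
Definition definable {V : structure} (P : (nat -> V) -> Prop) : Prop :=
  V -> exists (phi : formula) (c : nat -> V),
    forall e, P e <-> sat (interleave e c) phi.

(** The language has no function symbols: apart from variables, only parameters can stand in an
    atomic formula. *)
Definition definable_term {V : structure} (t : (nat -> V) -> V) : Prop :=
  (exists i, forall e, t e = e i) \/ (exists c, forall e, t e = c).

Section Definability.
Context {V : structure}.
Implicit Types P Q : (nat -> V) -> Prop.
Implicit Types s t u : (nat -> V) -> V.

Lemma term_var i : definable_term (fun e : nat -> V => e i).
Proof. left; exists i; auto. Qed.

Lemma term_const (c : V) : definable_term (fun _ => c).
Proof. right; exists c; auto. Qed.

Lemma definable_iff P Q (H : forall e, P e <-> Q e) :
  definable Q -> definable P.
Proof.
  intros HQ v; destruct (HQ v) as (phi & c & Hphi).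
  exists phi, c; intros e; rewrite H; auto.
Qed.

(** Two formulas come with two parameter streams. The streams are interleaved into one, and each
    formula is renamed to read its own half, so that both can enter one compound formula. *)
Lemma definable_join P Q (v : V) :
  definable P -> definable Q ->
  exists phi psi c, forall e, (P e <-> sat (interleave e c) phi) /\
                              (Q e <-> sat (interleave e c) psi).
Proof.
  intros HP HQ; destruct (HP v) as (phi & c & Hphi), (HQ v) as (psi & d & Hpsi).
  exists (rename (interleave double (fun n => S (double (double n)))) phi),
    (rename (interleave double (fun n => S (double (S (double n))))) psi),
    (interleave c d).
  intros e; split.
  - rewrite Hphi; apply sat_rename; intros n; apply interleave_map;
      intros k; [now rewrite interleave_even|].
    now rewrite interleave_odd, interleave_even.
  - rewrite Hpsi; apply sat_rename; intros n; apply interleave_map;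
      intros k; [now rewrite interleave_even|].
    now rewrite interleave_odd, interleave_odd.
Qed.

(** By excluded middle a proposition that does not depend on the environment is equivalent to truth
    or to falsity, whatever it says. Subformulas about fixed objects are therefore never
    inspected. *)
Lemma definable_const (A : Prop) : definable (fun _ : nat -> V => A).
Proof.
  intros v; destruct (classic A) as [H|H].
  - exists (FImp FFalse FFalse), (fun _ => v); simpl; tauto.
  - exists FFalse, (fun _ => v); simpl; tauto.
Qed.

Lemma definable_imp P Q :
  definable P -> definable Q -> definable (fun e => P e -> Q e).
Proof.
  intros HP HQ v; destruct (definable_join v HP HQ) as (phi & psi & c & H).
  exists (FImp phi psi), c; intros e; simpl; specialize (H e); tauto.
Qed.

Lemma definable_and P Q :
  definable P -> definable Q -> definable (fun e => P e /\ Q e).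
Proof.
  intros HP HQ v; destruct (definable_join v HP HQ) as (phi & psi & c & H).
  exists (FAnd phi psi), c; intros e; simpl; specialize (H e); tauto.
Qed.

Lemma definable_or P Q :
  definable P -> definable Q -> definable (fun e => P e \/ Q e).
Proof.
  intros HP HQ v; destruct (definable_join v HP HQ) as (phi & psi & c & H).
  exists (FOr phi psi), c; intros e; simpl; specialize (H e); tauto.
Qed.

Lemma definable_not P : definable P -> definable (fun e => ~ P e).
Proof. intros HP; apply definable_imp; auto using definable_const. Qed.

Lemma definable_equiv P Q :
  definable P -> definable Q -> definable (fun e => P e <-> Q e).
Proof. intros; apply definable_and; apply definable_imp; auto. Qed.

(** A quantifier puts its variable in front of the whole interleaved environment, which exchanges
    the parities of the old variables and the parameters. The renaming realigns them: 0 is kept,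
    position [2k + 2] goes to [2k + 1], and position [2k + 1] goes to [2k + 2]. *)
Lemma sat_under_binder (phi : formula) (e c : nat -> V) (x : V) :
  sat (interleave (scons x e) c) phi <->
  sat (scons x (interleave e c))
    (rename (interleave (scons 0 (fun n => S (double n)))
               (fun n => S (S (double n)))) phi).
Proof.
  apply sat_rename; intros n; apply interleave_map.
  - intros [|k]; cbn [scons]; auto. now rewrite interleave_even.
  - intros k; cbn [scons]. now rewrite interleave_odd.
Qed.

Lemma definable_all (Q : V -> (nat -> V) -> Prop) :
  definable (fun e => Q (e 0) (fun n => e (S n))) ->
  definable (fun e => forall x, Q x e).
Proof.
  intros HQ v; destruct (HQ v) as (phi & c & H).
  eexists (FAll _), c; intros e; simpl.
  split; intros H1 x; specialize (H1 x);
    [rewrite <- sat_under_binder|rewrite <- sat_under_binder in H1];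
    now apply (H (scons x e)).
Qed.

Lemma definable_ex (Q : V -> (nat -> V) -> Prop) :
  definable (fun e => Q (e 0) (fun n => e (S n))) ->
  definable (fun e => exists x, Q x e).
Proof.
  intros HQ v; destruct (HQ v) as (phi & c & H).
  eexists (FEx _), c; intros e; simpl.
  split; intros [x H1]; exists x;
    [rewrite <- sat_under_binder|rewrite <- sat_under_binder in H1];
    now apply (H (scons x e)).
Qed.

Lemma definable_term_join s t (v : V) :
  definable_term s -> definable_term t ->
  exists i j c, forall e, s e = interleave e c i /\ t e = interleave e c j.
Proof.
  intros [[i Hs]|[a Hs]] [[j Ht]|[b Ht]].
  - exists (double i), (double j), (fun _ => v); intros e.
    rewrite !interleave_even; auto.
  - exists (double i), 1, (fun _ => b); intros e.
    rewrite interleave_even; auto.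
  - exists 1, (double j), (fun _ => a); intros e.
    rewrite interleave_even; auto.
  - exists 1, 3, (scons a (fun _ => b)); intros e; simpl; auto.
Qed.

Lemma definable_mem s t :
  definable_term s -> definable_term t -> definable (fun e => s e ∈ t e).
Proof.
  intros Hs Ht v; destruct (definable_term_join v Hs Ht) as (i & j & c & H).
  exists (FMem i j), c; intros e; simpl; destruct (H e) as [-> ->]; tauto.
Qed.

Lemma definable_eq s t :
  definable_term s -> definable_term t -> definable (fun e => s e = t e).
Proof.
  intros Hs Ht v; destruct (definable_term_join v Hs Ht) as (i & j & c & H).
  exists (FEq i j), c; intros e; simpl; destruct (H e) as [-> ->]; tauto.
Qed.

Definition definable1 (P : V -> Prop) := definable (fun e => P (e 0)).
Definition definable2 (P : V -> V -> Prop) := definable (fun e => P (e 0) (e 1)).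
Definition definable3 (P : V -> V -> V -> Prop) :=
  definable (fun e => P (e 0) (e 1) (e 2)).

Lemma term_reindex s (f : nat -> nat) :
  definable_term s -> definable_term (fun e => s (fun n => e (f n))).
Proof.
  intros [[i H]|[c H]]; [left; exists (f i)|right; exists c];
    intros e; apply H.
Qed.

(** Substitution is expressed by a quantifier and an equation, so no substitution on formulas has to
    be defined. *)
Lemma definable1_app (P : V -> Prop) s :
  definable1 P -> definable_term s -> definable (fun e => P (s e)).
Proof.
  intros HP Hs.
  apply definable_iff with (fun e => exists x, P x /\ x = s e).
  { intros e; split; [eauto|intros (x & H & ->); auto]. }
  apply definable_ex.
  apply definable_and; [exact HP|].
  apply definable_eq; [apply term_var|exact (term_reindex S Hs)].
Qed.

(** As for one argument. The quantifiers stand in reverse order so that the innermost one, index 0,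
    is the first argument of [P]. *)
Lemma definable2_app (P : V -> V -> Prop) s t :
  definable2 P -> definable_term s -> definable_term t ->
  definable (fun e => P (s e) (t e)).
Proof.
  intros HP Hs Ht.
  apply definable_iff with
    (fun e => exists y x, P x y /\ x = s e /\ y = t e).
  { intros e; split; [eauto 6|intros (y & x & H & -> & ->); auto]. }
  do 2 apply definable_ex.
  apply definable_and; [exact HP|].
  apply definable_and; apply definable_eq; try apply term_var.
  - exact (term_reindex (fun n => S (S n)) Hs).
  - exact (term_reindex (fun n => S (S n)) Ht).
Qed.

Lemma definable3_app (P : V -> V -> V -> Prop) s t u :
  definable3 P -> definable_term s -> definable_term t -> definable_term u ->
  definable (fun e => P (s e) (t e) (u e)).
Proof.
  intros HP Hs Ht Hu.
  apply definable_iff with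
    (fun e => exists z y x, P x y z /\ x = s e /\ y = t e /\ z = u e).
  { intros e; split; [eauto 8|intros (z & y & x & H & -> & -> & ->); auto]. }
  do 3 apply definable_ex.
  apply definable_and; [exact HP|].
  repeat apply definable_and; apply definable_eq; try apply term_var.
  - exact (term_reindex (fun n => S (S (S n))) Hs).
  - exact (term_reindex (fun n => S (S (S n))) Ht).
  - exact (term_reindex (fun n => S (S (S n))) Hu).
Qed.
End Definability.

(** Follows the shape of the goal by second-order patterns and uses definability hypotheses for
    abstract predicates. The argument is tried when nothing else applies; it is [fail] until pairs
    and application are known to be definable. *)
Ltac definable_with unfolder :=
  unfold definable1, definable2, definable3 in *;
  repeat (cbv beta; first
    [ assumption
    | apply term_var
    | apply term_const
    | apply definable_const
    | lazymatch goal with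
      | |- definable (fun e => @?P e <-> @?Q e) => apply definable_equiv
      | |- definable (fun e => @?P e /\ @?Q e) => apply definable_and
      | |- definable (fun e => @?P e \/ @?Q e) => apply definable_or
      | |- definable (fun e => ~ @?P e) => apply definable_not
      | |- definable (fun e => @?P e -> @?Q e) => apply definable_imp
      | |- definable (fun e => forall x, @?Q e x) => apply definable_all
      | |- definable (fun e => exists x, @?Q e x) => apply definable_ex
      | |- definable (fun e => @?s e ∈ @?t e) => apply definable_mem
      | |- definable (fun e => @?s e = @?t e) => apply definable_eq
      end
    | match goal with
      | H : definable (fun e => ?P (e 0)) |- definable (fun e => ?P (@?s e)) =>
          apply (definable1_app H)
      | H : definable (fun e => ?P (e 0) (e 1))
        |- definable (fun e => ?P (@?s e) (@?t e)) =>
          apply (definable2_app H)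
      | H : definable (fun e => ?P (e 0) (e 1) (e 2))
        |- definable (fun e => ?P (@?s e) (@?t e) (@?u e)) =>
          apply (definable3_app H)
      end
    | unfolder ]).

(** * Set constructions *)

Section SetConstructions.
Context {V : structure} (HZF : ZF V).
Implicit Types a b c f g p q x y z u v : V.

Lemma definable_opair : definable3 (@is_opair V).
Proof. unfold is_opair, is_upair; definable_with fail. Qed.

Lemma definable_app : definable3 (@app V).
Proof. unfold app; pose proof definable_opair; definable_with fail. Qed.

Lemma ext a b : (forall z, z ∈ a <-> z ∈ b) -> a = b.
Proof. apply extensionality; auto. Qed.

Lemma separate (P : V -> Prop) (HP : definable1 P) a :
  exists b, forall z, z ∈ b <-> z ∈ a /\ P z.
Proof.
  destruct (HP a) as (phi & c & H).
  (* [P] reads only [e 0], so every environment variable may be sent to 0, the element being tested;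
     the parameters then occupy the indices from 1 on. *)
  destruct (separation HZF (rename (interleave (fun _ => 0) S) phi) c a)
    as [b Hb].
  exists b; intros z; rewrite Hb, (H (fun _ => z)).
  rewrite <- (@sat_rename _ phi _ _ (interleave (fun _ => z) c)); [tauto|].
  intros n; apply interleave_map; auto.
Qed.

Lemma replace (P : V -> V -> Prop) (HP : definable2 P) a :
  (forall x y y', x ∈ a -> P x y -> P x y' -> y = y') ->
  exists b, forall y, y ∈ b <-> exists x, x ∈ a /\ P x y.
Proof.
  destruct (HP a) as (phi & c & H); intros Hfun.
  set (psi := rename (interleave (fun n => match n with 0 => 0 | _ => 1 end)
                        (fun n => S (S n))) phi).
  assert (Hpsi : forall x y, P x y <-> sat (scons x (scons y c)) psi).
  { intros x y; rewrite (H (scons x (fun _ => y))).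
    apply sat_rename; intros n; apply interleave_map; auto.
    intros [|k]; reflexivity. }
  destruct (@replacement _ HZF psi c a) as [b Hb].
  { intros x y y'; rewrite <- !Hpsi; apply Hfun. }
  exists b; intros y; rewrite Hb; split; intros [x Hx]; exists x;
    [rewrite Hpsi|rewrite <- Hpsi]; exact Hx.
Qed.

Lemma upair_unique p q a b : is_upair p a b -> is_upair q a b -> p = q.
Proof. intros H H'; apply ext; intros z; rewrite (H z), (H' z); tauto. Qed.

Lemma opair_exists a b : exists p, is_opair p a b.
Proof.
  destruct (pairing HZF a a) as [s Hs], (pairing HZF a b) as [t Ht].
  destruct (pairing HZF s t) as [p Hp]; exists p, s, t; auto.
Qed.

Lemma opair_unique p q a b : is_opair p a b -> is_opair q a b -> p = q.
Proof.
  intros (s & t & Hs & Ht & Hp) (s' & t' & Hs' & Ht' & Hq).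
  rewrite (upair_unique Hs' Hs), (upair_unique Ht' Ht) in Hq.
  exact (upair_unique Hp Hq).
Qed.

Lemma opair_inj p a b c d : is_opair p a b -> is_opair p c d -> a = c /\ b = d.
Proof.
  intros (s & t & Hs & Ht & Hp) (s' & t' & Hs' & Ht' & Hp').
  assert (Hss : forall r, r = s \/ r = t <-> r = s' \/ r = t')
    by (intros r; rewrite <- (Hp r), <- (Hp' r); tauto).
  assert (Hac : a = c).
  { destruct (proj2 (Hss s') (or_introl eq_refl)) as [E|E]; subst s'.
    - destruct (proj1 (Hs' a)); auto; apply Hs; auto.
    - destruct (proj1 (Hs' a)); auto; apply Ht; auto. }
  subst c; split; auto.
  rewrite (upair_unique Hs' Hs) in *.
  assert (Hb : b ∈ t') .
  { destruct (proj1 (Hss t) (or_intror eq_refl)) as [E|E].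
    - assert (b = a) as -> by (destruct (proj1 (Hs b)); auto;
        rewrite <- E; apply Ht; auto). apply Ht'; auto.
    - rewrite <- E; apply Ht; auto. }
  assert (Hd : d ∈ t) .
  { destruct (proj2 (Hss t') (or_intror eq_refl)) as [E|E].
    - assert (d = a) as -> by (destruct (proj1 (Hs d)); auto;
        rewrite <- E; apply Ht'; auto). apply Ht; auto.
    - rewrite <- E; apply Ht'; auto. }
  apply Ht' in Hb; apply Ht in Hd; intuition congruence.
Qed.

Lemma cart_exists a b : exists p, is_cart p a b.
Proof.
  destruct (pairing HZF a b) as [ab Hab], (union HZF ab) as [u Hu].
  destruct (power_set HZF u) as [q Hq], (power_set HZF q) as [r Hr].
  destruct (@separate (fun z => exists x y, x ∈ a /\ y ∈ b /\ is_opair z x y))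
    with r as [p Hp].
  { pose proof definable_opair; definable_with fail. }
  exists p; intros z; rewrite (Hp z).
  split; [tauto|]; intros (x & y & Hx & Hy & Hz); split; [|eauto 6].
  assert (Hxu : x ∈ u) by (apply Hu; exists a; rewrite (Hab a); auto).
  assert (Hyu : y ∈ u) by (apply Hu; exists b; rewrite (Hab b); auto).
  destruct Hz as (s & t & Hs & Ht & Hz).
  apply Hr; intros w Hw; apply Hq; intros v Hv.
  apply Hz in Hw; destruct Hw as [-> | ->].
  - apply Hs in Hv; destruct Hv as [-> | ->]; auto.
  - apply Ht in Hv; destruct Hv as [-> | ->]; auto.
Qed.

Lemma family_build (P : V -> V -> Prop) (HP : definable2 P) a :
  (forall x, x ∈ a -> exists! y, P x y) ->
  exists f, is_family f a /\ forall x y, app f x y <-> x ∈ a /\ P x y.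
Proof.
  intros HPa.
  destruct (@replace (fun x p => exists y, P x y /\ is_opair p x y)) with a
    as [f Hf].
  { pose proof definable_opair; definable_with fail. }
  { intros x p p' Hx (y & Hy & Hp) (y' & Hy' & Hp').
    destruct (HPa x Hx) as (y0 & _ & Hu).
    rewrite <- (Hu y), <- (Hu y') in *; auto. eapply opair_unique; eauto. }
  assert (Hfa : forall x y, app f x y <-> x ∈ a /\ P x y).
  { intros x y; split.
    - intros (p & Hp & Hpf); apply Hf in Hpf.
      destruct Hpf as (x' & Hx' & y' & Hy' & Hp').
      destruct (opair_inj Hp Hp') as [-> ->]; auto.
    - intros [Hx Hy]; destruct (opair_exists x y) as [p Hp].
      exists p; split; auto; apply Hf; eauto. }
  exists f; split; auto; split.
  - intros p Hp; apply Hf in Hp; destruct Hp as (x & Hx & y & _ & Hp); eauto.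
  - intros x Hx; destruct (HPa x Hx) as (y & Hy & Hu).
    exists y; split; [apply Hfa; auto|]; intros y' H; apply Hfa in H.
    apply Hu; tauto.
Qed.

Lemma relation_build (P : V -> V -> Prop) (HP : definable2 P) a b :
  exists r, forall x y, app r x y <-> x ∈ a /\ y ∈ b /\ P x y.
Proof.
  destruct (cart_exists a b) as [c Hc].
  destruct (@separate (fun p => exists x y, P x y /\ is_opair p x y)) with c
    as [r Hr].
  { pose proof definable_opair; definable_with fail. }
  exists r; intros x y; split.
  - intros (p & Hp & Hpr); apply Hr in Hpr.
    destruct Hpr as [Hpc (x1 & y1 & H1 & Hp1)]; apply Hc in Hpc.
    destruct Hpc as (x2 & y2 & Hx2 & Hy2 & Hp2).
    destruct (opair_inj Hp Hp1) as [-> ->], (opair_inj Hp1 Hp2) as [-> ->]; auto.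
  - intros (Hx & Hy & Hxy); destruct (opair_exists x y) as [p Hp].
    exists p; split; auto; apply Hr; split; [apply Hc|]; eauto.
Qed.

Lemma family_dom f a x y : is_family f a -> app f x y -> x ∈ a.
Proof.
  intros [H _] (p & Hp & Hpf); destruct (H p Hpf) as (x' & y' & Hx' & Hp').
  destruct (opair_inj Hp Hp') as [-> _]; auto.
Qed.

Lemma family_total f a x : is_family f a -> x ∈ a -> exists y, app f x y.
Proof. intros [_ H] Hx; destruct (H x Hx) as (y & Hy & _); eauto. Qed.

Lemma family_unique f a x y y' :
  is_family f a -> app f x y -> app f x y' -> y = y'.
Proof.
  intros Hf Hy Hy'; destruct (proj2 Hf x (family_dom Hf Hy)) as (y0 & _ & H).
  rewrite <- (H y Hy); auto.
Qed.

(** One inclusion is enough because both families are total and single-valued on the same domain. *)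
Lemma family_ext f g a :
  is_family f a -> is_family g a -> (forall x y, app f x y -> app g x y) ->
  f = g.
Proof.
  intros Hf Hg H; apply ext; intros p; split; intros Hp.
  - destruct (proj1 Hf p Hp) as (x & y & Hx & Hxy).
    destruct (H x y) as (p' & Hp' & Hpg); [exists p; auto|].
    rewrite (opair_unique Hxy Hp'); auto.
  - destruct (proj1 Hg p Hp) as (x & y & Hx & Hxy).
    destruct (family_total Hf Hx) as [y' Hy'].
    assert (y' = y) as ->
      by (apply (family_unique Hg (H _ _ Hy')); exists p; auto).
    destruct Hy' as (p' & Hp' & Hpf); rewrite (opair_unique Hxy Hp'); auto.
Qed.

Lemma equipotent_intro (P : V -> V -> Prop) (HP : definable2 P) a b :
  (forall x, x ∈ a -> exists y, y ∈ b /\ P x y) ->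
  (forall y, y ∈ b -> exists x, x ∈ a /\ P x y) ->
  (forall x y y', x ∈ a -> y ∈ b -> y' ∈ b -> P x y -> P x y' -> y = y') ->
  (forall x x' y, x ∈ a -> x' ∈ a -> y ∈ b -> P x y -> P x' y -> x = x') ->
  equipotent a b.
Proof.
  intros Htot Hsur Hfun Hinj.
  destruct (@family_build (fun x y => y ∈ b /\ P x y)) with a as (f & Hf & Hfa).
  { definable_with fail. }
  { intros x Hx; destruct (Htot x Hx) as (y & Hy & Hxy); exists y.
    split; auto; intros y' [Hy' Hxy']; eauto. }
  exists f; split; [split; auto|].
  - intros x y H; apply Hfa in H; tauto.
  - intros y Hy; destruct (Hsur y Hy) as (x & Hx & Hxy); exists x.
    split; [apply Hfa; auto|]; intros x' H'; apply Hfa in H'.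
    apply (Hinj x x' y); tauto.
Qed.

Lemma app2_elim f p x y z : is_opair p x y -> app2 f x y z -> app f p z.
Proof. intros Hp (q & Hq & H); rewrite (opair_unique Hp Hq); auto. Qed.

Lemma fun2_total f c a b r x y :
  is_cart c a b -> is_fun f c r -> x ∈ a -> y ∈ b ->
  exists z, z ∈ r /\ app2 f x y z.
Proof.
  intros Hc [Hf Hr] Hx Hy; destruct (opair_exists x y) as [p Hp].
  destruct (@family_total f c p Hf) as [z Hz]; [apply Hc; eauto|].
  exists z; split; [eapply Hr; eauto|exists p; auto].
Qed.

Lemma fun2_dom f c a b r x y z :
  is_cart c a b -> is_fun f c r -> app2 f x y z -> x ∈ a /\ y ∈ b /\ z ∈ r.
Proof.
  intros Hc [Hf Hr] (p & Hp & Hz).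
  pose proof (family_dom Hf Hz) as H; apply Hc in H.
  destruct H as (x' & y' & Hx' & Hy' & Hp').
  destruct (opair_inj Hp Hp') as [-> ->]; eauto.
Qed.

Lemma fun2_unique f c r x y z z' :
  is_fun f c r -> app2 f x y z -> app2 f x y z' -> z = z'.
Proof.
  intros [Hf _] (p & Hp & Hz) H'; apply (app2_elim Hp) in H'.
  exact (family_unique Hf Hz H').
Qed.

Lemma not_mem_self x : x ∉ x.
Proof.
  intros Hx; destruct (pairing HZF x x) as [s Hs].
  destruct (foundation HZF (a := s)) as (y & Hy & H); [exists x; apply Hs; auto|].
  apply Hs in Hy; assert (y = x) by tauto; subst y.
  apply (H x Hx), Hs; auto.
Qed.

Lemma adjoin_exists a x : exists b, forall z, z ∈ b <-> z ∈ a \/ z = x.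
Proof.
  destruct (pairing HZF x x) as [s Hs], (pairing HZF a s) as [p Hp].
  destruct (union HZF p) as [u Hu]; exists u; intros z; rewrite (Hu z); split.
  - intros (y & Hy & Hz); apply Hp in Hy; destruct Hy as [-> | ->]; auto.
    apply Hs in Hz; tauto.
  - intros [H | ->]; [exists a|exists s]; rewrite (Hp _);
      [|rewrite (Hs _)]; auto.
Qed.

Lemma empty_exists : exists z, is_empty z.
Proof.
  destruct (infinity HZF) as (a & (z & Hz & _) & _); eauto.
Qed.

End SetConstructions.

Ltac solve_definable := definable_with ltac:(first
  [ match goal with
    | |- definable (fun e => is_opair (@?a e) (@?b e) (@?c e)) =>
        apply (definable3_app definable_opair)
    | |- definable (fun e => app (@?a e) (@?b e) (@?c e)) =>
        apply (definable3_app definable_app)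
    end
  | progress unfold unique, subset, is_empty, is_upair, is_union, is_power,
      is_succ, is_diff, inductive_set, is_omega, is_cart, app2, is_family,
      is_fun, is_bijection, equipotent, finite_set, is_half_power, Rlt ]).

(** * Natural numbers *)

Section NaturalNumbers.
Context {V : structure} (HZF : ZF V) (w : V) (Hw : is_omega w).
Implicit Types a b c f g p x y z k l m n s : V.

Lemma omega_unique w' : is_omega w' -> w' = w.
Proof.
  intros Hw'; apply (ext HZF); intros z; split;
    [apply (proj2 Hw'), Hw|apply (proj2 Hw), Hw'].
Qed.

Lemma zero_in z : is_empty z -> z ∈ w.
Proof.
  intros Hz; destruct Hw as [[(z' & Hz' & H) _] _].
  rewrite (ext HZF (a := z) (b := z')); auto.
  intros y; split; intros Hy; [destruct (Hz y Hy)|destruct (Hz' y Hy)].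
Qed.

Lemma succ_exists n : exists s, is_succ s n.
Proof. apply (adjoin_exists HZF). Qed.

Lemma succ_unique s s' n : is_succ s n -> is_succ s' n -> s = s'.
Proof.
  intros H H'; apply (ext HZF); intros z; rewrite (H z), (H' z); tauto.
Qed.

Lemma succ_in n s : n ∈ w -> is_succ s n -> s ∈ w.
Proof.
  intros Hn Hs; destruct Hw as [[_ H] _]; destruct (H n Hn) as (s' & Hs' & Hi).
  rewrite (succ_unique Hs Hs'); auto.
Qed.

Lemma omega_ind (P : V -> Prop) (HP : definable1 P) :
  (forall z, is_empty z -> P z) ->
  (forall n s, n ∈ w -> P n -> is_succ s n -> P s) ->
  forall n, n ∈ w -> P n.
Proof.
  intros H0 HS; destruct (separate HZF HP w) as [b Hb].
  assert (Hi : inductive_set b).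
  { split.
    - destruct (empty_exists HZF) as [z Hz]; exists z; split; auto.
      apply Hb; auto using zero_in.
    - intros n Hn; destruct (succ_exists n) as [s Hs]; exists s; split; auto.
      apply Hb in Hn; destruct Hn; apply Hb; split;
        [eapply succ_in|eapply HS]; eauto. }
  intros n Hn; apply (proj2 Hw _ Hi), Hb in Hn; tauto.
Qed.

Lemma mem_omega n m : n ∈ w -> m ∈ n -> m ∈ w.
Proof.
  intros Hn; revert m; pattern n; revert n Hn; apply omega_ind.
  - solve_definable.
  - intros z Hz m Hm; destruct (Hz m Hm).
  - intros n s Hn IH Hs m Hm; apply Hs in Hm; destruct Hm as [Hm | ->]; auto.
Qed.

Lemma mem_trans n m k : n ∈ w -> m ∈ n -> k ∈ m -> k ∈ n.
Proof.
  intros Hn; revert m k; pattern n; revert n Hn; apply omega_ind.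
  - solve_definable.
  - intros z Hz m k Hm; destruct (Hz m Hm).
  - intros n s Hn IH Hs m k Hm Hk; apply Hs; left; apply Hs in Hm.
    destruct Hm as [Hm | ->]; eauto.
Qed.

(** The order of [ω] is membership, so foundation provides the least element directly. *)
Lemma omega_least (P : V -> Prop) (HP : definable1 P) n :
  n ∈ w -> P n -> exists m, m ∈ w /\ P m /\ forall k, k ∈ m -> ~ P k.
Proof.
  intros Hn Hp; destruct (separate HZF HP w) as [b Hb].
  destruct (foundation HZF (a := b)) as (m & Hm & H); [exists n; apply Hb; auto|].
  apply Hb in Hm; destruct Hm as [Hm Hpm]; exists m; repeat split; auto.
  intros k Hk Hpk; apply (H k Hk), Hb; split; auto; eapply mem_omega; eauto.
Qed.

Lemma succ_le n s k : k ∈ w -> n ∈ k -> is_succ s n -> s ∈ k \/ s = k.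
Proof.
  intros Hk Hnk Hs; revert Hnk; pattern k; revert k Hk; apply omega_ind.
  - solve_definable.
  - intros z Hz H; destruct (Hz n H).
  - intros k t Hk IH Ht H; rewrite (Ht s); apply Ht in H.
    destruct H as [H | ->]; [tauto|].
    right; apply (succ_unique Hs Ht).
Qed.

Lemma omega_trichotomy n m :
  n ∈ w -> m ∈ w -> m ∈ n \/ m = n \/ n ∈ m.
Proof.
  intros Hn; revert m; pattern n; revert n Hn; apply omega_ind.
  - solve_definable.
  - intros z Hz m Hm; pattern m; revert m Hm; apply omega_ind.
    + solve_definable.
    + intros z' Hz'; right; left; apply (ext HZF); intros y; split; intros Hy;
        [destruct (Hz' y Hy)|destruct (Hz y Hy)].
    + intros m s Hm IH Hs; right; right; apply Hs.
      destruct IH as [H | [-> | H]]; auto; destruct (Hz m H).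
  - intros n s Hn IH Hs m Hm.
    destruct (IH m Hm) as [H | [-> | H]].
    + left; apply Hs; auto.
    + left; apply Hs; auto.
    + destruct (succ_le Hm H Hs); auto.
Qed.

Lemma omega_bound2 n m :
  n ∈ w -> m ∈ w -> exists k, k ∈ w /\ n ∈ k /\ m ∈ k.
Proof.
  intros Hn Hm; destruct (omega_trichotomy Hn Hm) as [H | [-> | H]];
    [destruct (succ_exists n) as [s Hs]|destruct (succ_exists n) as [s Hs]
    |destruct (succ_exists m) as [s Hs]];
    exists s; split; eauto using succ_in; split; apply Hs; auto.
Qed.

End NaturalNumbers.

Lemma omega_exists (V : structure) (HZF : ZF V) : exists w : V, is_omega w.
Proof.
  destruct (infinity HZF) as [a Ha].
  destruct (separate HZF (P := fun n => forall b, inductive_set b -> n ∈ b))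
    with a as [w Hw]; [solve_definable|].
  exists w; split.
  - split.
    + destruct Ha as [(z & Hz & Hza) _]; exists z; split; auto.
      apply Hw; split; auto; intros b [(z' & Hz' & Hb) _].
      rewrite (ext HZF (a := z) (b := z')); auto.
      intros y; split; intros Hy; [destruct (Hz y Hy)|destruct (Hz' y Hy)].
    + intros n Hn; apply Hw in Hn; destruct Hn as [Hna Hn].
      destruct (succ_exists HZF n) as [s Hs]; exists s; split; auto.
      assert (H : forall b, inductive_set b -> s ∈ b).
      { intros b Hb; destruct (proj2 Hb n (Hn b Hb)) as (s' & Hs' & H).
        rewrite (succ_unique HZF Hs Hs'); auto. }
      apply Hw; auto.
  - intros b Hb n Hn; apply Hw in Hn; destruct Hn; auto.
Qed.

(** * Finite and countable sets *)

Section FiniteSets.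
Context {V : structure} (HZF : ZF V) (w : V) (Hw : is_omega w).
Implicit Types a b c f g p x y z k l m n s : V.

Lemma finite_intro a n : n ∈ w -> equipotent a n -> finite_set a.
Proof. exists w, n; auto. Qed.

Lemma finite_elim a : finite_set a -> exists n, n ∈ w /\ equipotent a n.
Proof.
  intros (w' & n & Hw' & Hn & H); exists n.
  rewrite <- (omega_unique HZF Hw Hw'); auto.
Qed.

Lemma finite_empty a : is_empty a -> finite_set a.
Proof.
  intros Ha; apply (finite_intro (zero_in HZF Hw Ha)).
  apply (equipotent_intro HZF (P := fun _ _ => False)).
  - solve_definable.
  - intros x Hx; destruct (Ha x Hx).
  - intros x Hx; destruct (Ha x Hx).
  - tauto.
  - tauto.
Qed.

Lemma finite_adjoin a b x :
  finite_set a -> (forall z, z ∈ b <-> z ∈ a \/ z = x) -> finite_set b.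
Proof.
  intros Ha Hb; destruct (classic (x ∈ a)) as [Hx | Hx].
  { rewrite (ext HZF (a := b) (b := a)); auto.
    intros z; rewrite Hb; split; [intros [H | ->]|]; auto. }
  destruct (finite_elim Ha) as (n & Hn & f & Hf & Hfb).
  destruct (succ_exists HZF n) as [s Hs].
  apply (finite_intro (succ_in HZF Hw Hn Hs)).
  apply (equipotent_intro HZF
    (P := fun u v => (u ∈ a /\ app f u v) \/ (u = x /\ v = n))).
  - solve_definable.
  - intros u Hu; apply Hb in Hu; destruct Hu as [Hu | ->].
    + destruct (family_total (proj1 Hf) Hu) as [v Hv]; exists v.
      split; auto; apply Hs; left; eapply (proj2 Hf); eauto.
    + exists n; split; auto; apply Hs; auto.
  - intros v Hv; apply Hs in Hv; destruct Hv as [Hv | ->].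
    + destruct (Hfb v Hv) as (u & Hu & _); exists u.
      pose proof (family_dom HZF (proj1 Hf) Hu).
      split; auto; apply Hb; auto.
    + exists x; split; auto; apply Hb; auto.
  - intros u v v' _ _ _ [[Hu Hv] | [-> ->]] [[Hu' Hv'] | [E ->]]; auto.
    + exact (family_unique HZF (proj1 Hf) Hv Hv').
    + subst; tauto.
    + tauto.
  - intros u u' v _ _ _ [[Hu Hv] | [-> ->]] [[Hu' Hv'] | [-> E]]; auto.
    + destruct (Hfb v) as (u0 & _ & H); [eapply (proj2 Hf); eauto|].
      rewrite <- (H u Hv); auto.
    + subst v; destruct (not_mem_self HZF (x := n)); eapply (proj2 Hf); eauto.
    + destruct (not_mem_self HZF (x := n)); eapply (proj2 Hf); eauto.
Qed.

(** Induction on the size, for all sets of that size together: from a set of size [n + 1] the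
    element matched with [n] is removed. *)
Lemma finite_ind (P : V -> Prop) (HP : definable1 P) :
  (forall z, is_empty z -> P z) ->
  (forall a b x, finite_set a -> P a ->
     (forall z, z ∈ b <-> z ∈ a \/ z = x) -> P b) ->
  forall a, finite_set a -> P a.
Proof.
  intros H0 HS a Ha; destruct (finite_elim Ha) as (n & Hn & Hfa).
  clear Ha; revert a Hfa; pattern n; revert n Hn; apply (omega_ind HZF Hw).
  - solve_definable.
  - intros z Hz a (f & Hf & Hfb); apply H0; intros x Hx.
    destruct (family_total (proj1 Hf) Hx) as [y Hy].
    apply (Hz y); eapply (proj2 Hf); eauto.
  - intros n s Hn IH Hs a (f & Hf & Hfb).
    destruct (Hfb n) as (x & Hx & Hxu); [apply Hs; auto|].
    destruct (separate HZF (P := fun z => z <> x)) with a as [a' Ha'];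
      [solve_definable|].
    assert (He : equipotent a' n).
    { apply (equipotent_intro HZF (P := app f)).
      - solve_definable.
      - intros u Hu; apply Ha' in Hu; destruct Hu as [Hu Hux].
        destruct (family_total (proj1 Hf) Hu) as [y Hy]; exists y.
        split; auto; pose proof (proj2 Hf _ _ Hy) as H; apply Hs in H.
        destruct H as [H | ->]; auto; destruct Hux; rewrite (Hxu u); auto.
      - intros y Hy; destruct (Hfb y) as (u & Hu & _); [apply Hs; auto|].
        exists u; split; auto; apply Ha'; split;
          [eapply (family_dom HZF); eauto; apply Hf|].
        intros ->; rewrite (family_unique HZF (proj1 Hf) Hu Hx) in Hy.
        apply (not_mem_self HZF Hy).
      - intros u y y' _ _ _; apply (family_unique HZF (proj1 Hf)).
      - intros u u' y _ _ Hy Hu Hu'; destruct (Hfb y) as (u0 & _ & H);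
          [apply Hs; auto|].
        rewrite <- (H u Hu); auto. }
    apply HS with a' x; eauto using finite_intro.
    intros z; rewrite Ha'; split; [intros Hz; destruct (classic (z = x)); auto|].
    intros [[H _] | ->]; auto; eapply (family_dom HZF); eauto; apply Hf.
Qed.

Lemma finite_subset a b : finite_set a -> subset b a -> finite_set b.
Proof.
  intros Ha; revert b; pattern a; revert a Ha; apply finite_ind.
  - solve_definable.
  - intros z Hz b Hb; apply finite_empty; intros x Hx; apply (Hz x); auto.
  - intros a a' x Ha IH Ha' b Hb.
    destruct (separate HZF (P := fun z => z <> x)) with b as [b' Hb'];
      [solve_definable|].
    assert (H : finite_set b').
    { apply IH; intros z Hz; apply Hb' in Hz; destruct Hz as [Hz Hzx].
      apply Hb, Ha' in Hz; tauto. }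
    destruct (classic (x ∈ b)) as [Hx | Hx].
    + apply finite_adjoin with b' x; auto; intros z; rewrite Hb'.
      split; [intros Hz; destruct (classic (z = x)); auto|].
      intros [[Hz _] | ->]; auto.
    + rewrite (ext HZF (a := b) (b := b')); auto; intros z; rewrite Hb'.
      split; [|tauto]; intros Hz; split; auto; intros ->; auto.
Qed.

Lemma finite_union a b c :
  finite_set a -> finite_set b -> (forall z, z ∈ c -> z ∈ a \/ z ∈ b) ->
  finite_set c.
Proof.
  intros Ha Hb; revert c; pattern a; revert a Ha; apply finite_ind.
  - solve_definable.
  - intros z Hz c Hc; apply finite_subset with b; auto.
    intros x Hx; destruct (Hc x Hx); auto; destruct (Hz x); auto.
  - intros a a' x Ha IH Ha' c Hc.
    destruct (separate HZF (P := fun z => z <> x)) with c as [c' Hc'];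
      [solve_definable|].
    assert (H : finite_set c').
    { apply IH; intros z Hz; apply Hc' in Hz; destruct Hz as [Hz Hzx].
      apply Hc in Hz; rewrite Ha' in Hz; tauto. }
    destruct (adjoin_exists HZF c' x) as [d Hd].
    apply finite_subset with d; [eapply finite_adjoin; eauto|].
    intros z Hz; apply Hd; rewrite Hc'; destruct (classic (z = x)); auto.
Qed.

Lemma finite_singleton a x : (forall z, z ∈ a -> z = x) -> finite_set a.
Proof.
  intros Ha; destruct (empty_exists HZF) as [z Hz].
  destruct (adjoin_exists HZF z x) as [b Hb].
  apply finite_subset with b; [eapply finite_adjoin; eauto using finite_empty|].
  intros y Hy; apply Hb; auto.
Qed.

(** Induction on [n]: at most one element is related to the top number, and the others are related
    to smaller ones. An element may have several values. *)
Lemma finite_of_injection (P : V -> V -> Prop) (HP : definable2 P) n a :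
  n ∈ w -> (forall x x' k, P x k -> P x' k -> x = x') ->
  (forall x, x ∈ a -> exists k, k ∈ n /\ P x k) -> finite_set a.
Proof.
  intros Hn Hinj; revert a; pattern n; revert n Hn; apply (omega_ind HZF Hw).
  - solve_definable.
  - intros z Hz a Ha; apply finite_empty; intros x Hx.
    destruct (Ha x Hx) as (k & Hk & _); apply (Hz k Hk).
  - intros n s Hn IH Hs a Ha.
    destruct (separate HZF (P := fun x => P x n)) with a as [b Hb];
      [solve_definable|].
    destruct (separate HZF (P := fun x => ~ P x n)) with a as [c Hc];
      [solve_definable|].
    apply finite_union with b c.
    + destruct (classic (exists x, x ∈ b)) as [[x Hx] | H].
      * apply finite_singleton with x; intros z Hz.
        apply Hb in Hx; apply Hb in Hz; apply (Hinj z x n); tauto.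
      * apply finite_empty; intros x Hx; eauto.
    + apply IH; intros x Hx; apply Hc in Hx; destruct Hx as [Hx Hxn].
      destruct (Ha x Hx) as (k & Hk & Hxk); exists k; split; auto.
      apply Hs in Hk; destruct Hk as [Hk | ->]; tauto.
    + intros z Hz; rewrite Hb, Hc; tauto.
Qed.

(** Stands for taking the maximum of finitely many bounds. Since [P] is upward closed, a bound for
    the smaller set and one for the new element have a common upper bound, and no function from
    elements to bounds is formed. *)
Lemma finite_bound (P : V -> V -> Prop) (HP : definable2 P) a :
  finite_set a ->
  (forall x n m, P x m -> n ∈ w -> m ∈ n -> P x n) ->
  (forall x, x ∈ a -> exists n, n ∈ w /\ P x n) ->
  exists n, n ∈ w /\ forall x, x ∈ a -> P x n.
Proof.
  intros Ha Hup; pattern a; revert a Ha; apply finite_ind.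
  - solve_definable.
  - intros z Hz _; destruct (empty_exists HZF) as [n Hn].
    exists n; split; [eapply zero_in; eauto|intros x Hx; destruct (Hz x Hx)].
  - intros a b x Ha IH Hb H.
    destruct IH as (n & Hn & HPn); [intros y Hy; apply H, Hb; auto|].
    destruct (H x) as (m & Hm & HPm); [apply Hb; auto|].
    destruct (omega_bound2 HZF Hw Hn Hm) as (k & Hk & Hnk & Hmk).
    exists k; split; auto; intros y Hy; apply Hb in Hy.
    destruct Hy as [Hy | ->]; eauto.
Qed.

Lemma denumerable_not_finite a : denumerable a -> ~ finite_set a.
Proof.
  intros (w' & Hw' & f & Hf & Hfb) Ha.
  rewrite (omega_unique HZF Hw Hw') in *; clear w' Hw'.
  (* If the set were finite, one [n] would exceed all values of the bijection, yet [n] is itself a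
     value. *)
  destruct (finite_bound (P := fun x n => forall k, app f x k -> k ∈ n))
    with a as (n & Hn & H); auto.
  - solve_definable.
  - intros x n m Hm Hn Hmn k Hk; eapply (mem_trans HZF Hw); eauto.
  - intros x Hx; destruct (family_total (proj1 Hf) Hx) as [k Hk].
    pose proof (proj2 Hf _ _ Hk) as Hkw.
    destruct (succ_exists HZF k) as [s Hs]; exists s.
    split; [eapply succ_in; eauto|]; intros k' Hk'; apply Hs; right.
    exact (family_unique HZF (proj1 Hf) Hk' Hk).
  - destruct (Hfb n Hn) as (x & Hx & _); apply (not_mem_self HZF (x := n)).
    apply (H x); auto; eapply (family_dom HZF); eauto; apply Hf.
Qed.

(** An element may have many indices; the least one, given by [Q], is a canonical choice and defines
    an injection into [ω]. *)
Lemma countable_intro (P : V -> V -> Prop) (HP : definable2 P) a :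
  (forall x, x ∈ a -> exists n, n ∈ w /\ P x n) ->
  (forall x y n, x ∈ a -> y ∈ a -> n ∈ w -> P x n -> P y n -> x = y) ->
  countable_set a.
Proof.
  intros Htot Hinj.
  set (Q := fun x n => P x n /\ forall m, m ∈ n -> ~ P x m).
  destruct (separate HZF (P := fun n => exists x, x ∈ a /\ Q x n)) with w
    as [b Hb]; [unfold Q; solve_definable|].
  exists w, b; split; auto; split; [intros n Hn; apply Hb in Hn; tauto|].
  apply (equipotent_intro HZF (P := Q)).
  - unfold Q; solve_definable.
  - intros x Hx; destruct (Htot x Hx) as (n & Hn & Hxn).
    destruct (omega_least HZF Hw (P := P x)) with n as (m & Hm & HQ); auto;
      [solve_definable|].
    exists m; split; auto; apply Hb; eauto.
  - intros n Hn; apply Hb in Hn; tauto.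
  - intros x n m _ Hn Hm [Hxn Hxn'] [Hxm Hxm'].
    apply Hb in Hn; apply Hb in Hm.
    destruct (omega_trichotomy HZF Hw (n := n) (m := m)) as [H | [H | H]];
      try tauto; [destruct (Hxn' m H)|auto|destruct (Hxm' n H)]; auto.
  - intros x y n Hx Hy Hn [Hxn _] [Hyn _]; apply (Hinj x y n); auto.
    apply Hb in Hn; tauto.
Qed.

Lemma countable_elim a :
  countable_set a ->
  exists f, is_fun f a w /\
    forall x y n, app f x n -> app f y n -> x = y.
Proof.
  intros (w' & b & Hw' & Hb & f & [Hf Hfb] & Hbij).
  rewrite (omega_unique HZF Hw Hw') in *.
  exists f; split; [split; eauto|].
  intros x y n Hx Hy; destruct (Hbij n) as (z & _ & H); eauto.
  rewrite <- (H x Hx); auto.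
Qed.

End FiniteSets.

(** * Real arithmetic *)

Section RealArithmetic.
Context {V : structure} (HZF : ZF V) (R : real_line V).
Implicit Types a b c d s t x y z : V.

Local Notation real x := (x ∈ Rset R).
Local Notation add := (app2 (Radd R)).
Local Notation mul := (app2 (Rmul R)).
Local Notation le := (app (Rle R)).
Local Notation lt := (Rlt R).

Lemma add_total x y : real x -> real y -> exists z, real z /\ add x y z.
Proof.
  destruct (Radd_fun R) as (RR & Hc & Hf).
  intros Hx Hy; exact (fun2_total HZF Hc Hf Hx Hy).
Qed.

Lemma add_real x y z : add x y z -> real x /\ real y /\ real z.
Proof.
  destruct (Radd_fun R) as (RR & Hc & Hf); exact (fun2_dom HZF Hc Hf).
Qed.

Lemma add_unique x y z z' : add x y z -> add x y z' -> z = z'.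
Proof.
  destruct (Radd_fun R) as (RR & Hc & Hf); exact (fun2_unique HZF Hf).
Qed.

Lemma mul_total x y : real x -> real y -> exists z, real z /\ mul x y z.
Proof.
  destruct (Rmul_fun R) as (RR & Hc & Hf).
  intros Hx Hy; exact (fun2_total HZF Hc Hf Hx Hy).
Qed.

Lemma le_real x y : le x y -> real x /\ real y.
Proof.
  destruct (Rle_rel R) as (RR & Hc & Hs); intros (p & Hp & Hle).
  apply Hs, Hc in Hle; destruct Hle as (x' & y' & Hx & Hy & Hp').
  destruct (opair_inj HZF Hp Hp') as [-> ->]; auto.
Qed.

Lemma add_zero_l x : real x -> add (Rzero R) x x.
Proof. intros Hx; apply Radd_comm, Radd_zero; auto. Qed.

Lemma add_cancel x y z s : add x z s -> add y z s -> x = y.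
Proof.
  intros Hx Hy; destruct (add_real Hx) as (Rx & Rz & Rs).
  destruct (add_real Hy) as (Ry & _ & _).
  destruct (Radd_opp Rz) as (z' & Rz' & Hz').
  destruct (add_total Rs Rz') as (t & _ & Ht).
  rewrite (add_unique (Radd_zero Rx) (Radd_assoc Hx Hz' Ht)).
  exact (add_unique (Radd_assoc Hy Hz' Ht) (Radd_zero Ry)).
Qed.

Lemma lt_le_trans x y z : lt x y -> le y z -> lt x z.
Proof.
  intros [Hxy Hne] Hyz; split; [eapply Rle_trans; eauto|].
  intros <-; apply Hne, (@Rle_antisym V R); auto.
Qed.

Lemma le_lt_trans x y z : le x y -> lt y z -> lt x z.
Proof.
  intros Hxy [Hyz Hne]; split; [eapply Rle_trans; eauto|].
  intros ->; apply Hne, (@Rle_antisym V R); auto.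
Qed.

Lemma lt_not_le x y : lt x y -> ~ le y x.
Proof. intros [H Hne] H'; apply Hne, (@Rle_antisym V R); auto. Qed.

Lemma not_lt_le x y : real x -> real y -> ~ lt x y -> le y x.
Proof.
  intros Hx Hy H; destruct (Rle_total Hx Hy) as [Hle | Hle]; auto.
  destruct (classic (x = y)) as [-> | Hne]; auto; destruct H; split; auto.
Qed.

Lemma lt_add_r x y z a b : lt x y -> add x z a -> add y z b -> lt a b.
Proof.
  intros [Hle Hne] Ha Hb; split; [eapply Rle_add; eauto|].
  intros ->; apply Hne; exact (add_cancel Ha Hb).
Qed.

Lemma lt_add a b c d s t :
  lt a c -> lt b d -> add a b s -> add c d t -> lt s t.
Proof.
  intros Hac Hbd Hs Ht; destruct (add_real Hs) as (_ & Rb & _).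
  destruct (add_real Ht) as (Rc & _ & _).
  destruct (add_total Rc Rb) as (u & _ & Hu).
  apply lt_le_trans with u; [exact (lt_add_r Hac Hs Hu)|].
  apply (lt_add_r Hbd (Radd_comm Hu) (Radd_comm Ht)).
Qed.

Lemma le_add_nonneg b c s : le (Rzero R) c -> add b c s -> le b s.
Proof.
  intros Hc Hs; destruct (add_real Hs) as (Rb & _ & _).
  exact (Rle_add Hc (add_zero_l Rb) (Radd_comm Hs)).
Qed.

Lemma mul_zero x : real x -> mul x (Rzero R) (Rzero R).
Proof.
  intros Rx; destruct (mul_total Rx (Rzero_in R)) as (z & Rz & Hz).
  destruct (add_total Rz Rz) as (s & _ & Hs).
  assert (Hzz : add z z z)
    by exact (Rdistr (Radd_zero (Rzero_in R)) Hz Hz Hz).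
  rewrite (add_cancel Hzz (add_zero_l Rz)) in Hz; auto.
Qed.

Lemma zero_lt_one : lt (Rzero R) (Rone R).
Proof.
  split; [|intros E; symmetry in E; exact (Rone_neq_zero E)].
  destruct (Rle_total (Rzero_in R) (Rone_in R)) as [H | H]; auto.
  (* Otherwise [-1 >= 0], so [1 = (-1)(-1) >= 0]. *)
  destruct (Radd_opp (Rone_in R)) as (u & Ru & Hu).
  assert (H0u : le (Rzero R) u) by exact (Rle_add H Hu (add_zero_l Ru)).
  destruct (mul_total Ru Ru) as (v & Rv & Hv).
  assert (Hs : add u v (Rzero R))
    by exact (Rdistr Hu (Rmul_one Ru) Hv (mul_zero Ru)).
  rewrite <- (add_cancel (Radd_comm Hs) Hu); exact (Rle_mul H0u H0u Hv).
Qed.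

Lemma half_exists x : real x -> exists y, real y /\ add y y x.
Proof.
  intros Rx.
  destruct (add_total (Rone_in R) (Rone_in R)) as (two & R2 & H2).
  assert (Hne : two <> Rzero R).
  { intros ->; destruct zero_lt_one as [Hle Hne]; apply Hne.
    apply (@Rle_antisym V R); auto.
    exact (le_add_nonneg Hle H2). }
  (* [h] is one half: distributivity turns [h (1 + 1) = 1] into [h + h = 1], and then
     [x (h + h) = x] into [y + y = x] for [y = x h]. *)
  destruct (Rmul_inv R2 Hne) as (h & Rh & Hh).
  assert (Hhh : add h h (Rone R))
    by exact (Rdistr H2 (Rmul_one Rh) (Rmul_one Rh) (Rmul_comm Hh)).
  destruct (mul_total Rx Rh) as (y & Ry & Hy); exists y; split; auto.
  exact (Rdistr Hhh Hy Hy (Rmul_one Rx)).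
Qed.

Lemma half_pos x y : add y y x -> lt (Rzero R) x -> lt (Rzero R) y /\ lt y x.
Proof.
  intros Hx Hpos; destruct (add_real Hx) as (Ry & _ & _).
  assert (H : lt (Rzero R) y).
  { apply NNPP; intros H; apply (lt_not_le Hpos).
    apply not_lt_le in H; auto using Rzero_in.
    eapply Rle_trans; [|exact H].
    exact (Rle_add H Hx (add_zero_l Ry)). }
  split; auto; exact (lt_add_r H (add_zero_l Ry) Hx).
Qed.

Lemma half_unique x y y' : add y y x -> add y' y' x -> y = y'.
Proof.
  intros Hy Hy'; apply NNPP; intros Hne.
  destruct (add_real Hy) as (Ry & _ & Rx), (add_real Hy') as (Ry' & _ & _).
  destruct (Rle_total Ry Ry') as [H | H].
  - destruct (lt_add (conj H Hne) (conj H Hne) Hy Hy'); auto.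
  - assert (H' : lt y' y) by (split; auto).
    destruct (lt_add H' H' Hy' Hy); auto.
Qed.

End RealArithmetic.

(** * Powers of one half *)

Section HalfPowers.
Context {V : structure} (HZF : ZF V) (w : V) (Hw : is_omega w).
Context (R : real_line V).
Implicit Types e f h k m n s x y z : V.

Local Notation real x := (x ∈ Rset R).
Local Notation add := (app2 (Radd R)).
Local Notation lt := (Rlt R).

Definition halving_sequence h : Prop :=
  (forall z, is_empty z -> app h z (Rone R)) /\
  (forall k sk x y, is_succ sk k -> app h k x -> app h sk y -> add y y x).

Lemma succ_inj n m s : n ∈ w -> m ∈ w -> is_succ s n -> is_succ s m -> n = m.
Proof.
  intros Hn Hm Hs Hs'.
  assert (H : n ∈ s) by (apply Hs; auto); apply Hs' in H.
  assert (H' : m ∈ s) by (apply Hs'; auto); apply Hs in H'.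
  destruct H as [H | H], H' as [H' | H']; auto.
  destruct (not_mem_self HZF (mem_trans HZF Hw Hm H H')).
Qed.

(** The recursion is solved by the smallest relation containing [(0, 1)] and
    closed under [(k, y + y) |-> (k + 1, y)]. *)
Lemma halving_sequence_exists :
  exists h, is_fun h w (Rset R) /\ halving_sequence h.
Proof.
  set (closed := fun S =>
    (forall z, is_empty z -> app S z (Rone R)) /\
    (forall k sk x y, k ∈ w -> is_succ sk k -> app S k x -> add y y x ->
       app S sk y)).
  set (Q := fun n x => real x /\ forall S, closed S -> app S n x).
  assert (HdQ : definable2 Q) by (unfold Q, closed; solve_definable).
  assert (Q0 : forall z, is_empty z -> Q z (Rone R)).
  { intros z Hz; split; [apply Rone_in|intros S HS; apply HS; auto]. }
  assert (QS : forall k sk x y, k ∈ w -> is_succ sk k -> Q k x -> add y y x ->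
             Q sk y).
  { intros k sk x y Hk Hs [_ HQ] Hy; split; [apply (add_real HZF Hy)|].
    intros S HS; eapply (proj2 HS); eauto. }
  assert (HQ : forall n, n ∈ w -> exists! x, Q n x).
  { apply (omega_ind HZF Hw); [solve_definable| |].
    - intros z Hz; exists (Rone R); split; auto; intros y [_ Hy].
      (* A test relation that allows only 1 at zero and every real elsewhere. It is closed because
         successors are not empty, so minimality forces the value 1 at zero. *)
      destruct (@relation_build V HZF (fun n x => is_empty n -> x = Rone R))
        with w (Rset R) as [S HS]; [solve_definable|].
      assert (H : closed S).
      { split.
        - intros z' Hz'; apply HS.
          split; [eapply zero_in; eauto|]; auto using Rone_in.
        - intros k sk x' y' Hk Hsk _ Hy'; apply HS.
          split; [eapply succ_in; eauto|]; split; [apply (add_real HZF Hy')|].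
          intros H; destruct (H k); apply Hsk; auto. }
      apply Hy, HS in H; symmetry; apply H; auto.
    - intros n s Hn (x & Hx & Hxu) Hs.
      destruct (half_exists HZF (proj1 Hx)) as (y & Ry & Hy).
      exists y; split; [eapply QS; eauto|]; intros y' [_ Hy'].
      (* The test relation for the value at [s]. Its part [Q] keeps the value at [n] equal to [x],
         so closure can produce at [s] nothing but the half [y] of [x]. *)
      destruct (@relation_build V HZF (fun m z => Q m z /\ (m = s -> z = y)))
        with w (Rset R) as [S HS]; [solve_definable|].
      assert (H : closed S).
      { split.
        - intros z Hz; apply HS; split; [eapply zero_in; eauto|].
          split; [apply Rone_in|]; split; auto.
          intros ->; destruct (Hz n); apply Hs; auto.
        - intros k sk u v Hk Hsk Hu Hv; apply HS in Hu.
          destruct Hu as (_ & _ & Hu & _); apply HS.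
          split; [eapply succ_in; eauto|]; split; [apply (add_real HZF Hv)|].
          split; [eapply QS; eauto|]; intros ->.
          assert (k = n) as -> by (eapply succ_inj; eauto).
          rewrite <- (Hxu u Hu) in Hv; apply (half_unique HZF Hv Hy). }
      apply Hy', HS in H; symmetry; apply H; auto. }
  destruct (family_build HZF HdQ (a := w)) as (h & Hh & Hhq); auto.
  exists h; split; [split; auto|split].
  - intros n x H; apply Hhq in H; apply H.
  - intros z Hz; apply Hhq; split; [eapply zero_in|]; eauto.
  - intros k sk x y Hs Hx Hy; apply Hhq in Hx; apply Hhq in Hy.
    destruct Hx as [Hk Hx], Hy as [Hsk Hy].
    destruct (half_exists HZF (proj1 Hx)) as (y' & _ & Hy').
    destruct (HQ sk Hsk) as (u & _ & Hu).
    assert (y = y') as ->; [|auto].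
    rewrite <- (Hu y Hy); apply Hu, (QS k sk x y'); auto.
Qed.

Lemma halving_sequence_unique h h' n x x' :
  is_fun h w (Rset R) -> halving_sequence h ->
  is_fun h' w (Rset R) -> halving_sequence h' ->
  app h n x -> app h' n x' -> x = x'.
Proof.
  intros Hf [H0 HS] Hf' [H0' HS'] Hx.
  pose proof (family_dom HZF (proj1 Hf) Hx) as Hn.
  revert x x' Hx; pattern n; revert n Hn; apply (omega_ind HZF Hw).
  - solve_definable.
  - intros z Hz x x' Hx Hx'.
    rewrite (family_unique HZF (proj1 Hf) Hx (H0 z Hz)).
    apply (family_unique HZF (proj1 Hf') (H0' z Hz) Hx').
  - intros n s Hn IH Hs x x' Hx Hx'.
    destruct (family_total (proj1 Hf) Hn) as [y Hy].
    destruct (family_total (proj1 Hf') Hn) as [y' Hy'].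
    pose proof (HS _ _ _ _ Hs Hy Hx) as H.
    pose proof (HS' _ _ _ _ Hs Hy' Hx') as H'.
    rewrite (IH _ _ Hy Hy') in H; apply (half_unique HZF H H').
Qed.

(** With one graph [h] fixed, the existential statement [is_half_power] becomes [app h n e], to
    which the lemmas on families and induction on [n] apply. *)
Lemma half_power_graph :
  exists h, is_fun h w (Rset R) /\ halving_sequence h /\
    forall n e, is_half_power R n e <-> app h n e.
Proof.
  destruct halving_sequence_exists as (h & Hf & Hh); exists h.
  split; [|split]; auto; intros n e; split.
  - intros (w' & h' & Hw' & Hf' & H0 & HS & He).
    rewrite (omega_unique HZF Hw Hw') in *.
    destruct (family_total (proj1 Hf) (family_dom HZF (proj1 Hf') He))
      as [e' He'].
    rewrite (halving_sequence_unique (h := h') (h' := h) (n := n)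
               (x := e) (x' := e')); auto; split; auto.
  - intros He; exists w, h; destruct Hh; auto.
Qed.

Lemma half_power_exists n : n ∈ w -> exists e, is_half_power R n e.
Proof.
  intros Hn; destruct half_power_graph as (h & Hf & _ & Hg).
  destruct (family_total (proj1 Hf) Hn) as [e He]; exists e; apply Hg; auto.
Qed.

Lemma half_power_unique n e e' :
  is_half_power R n e -> is_half_power R n e' -> e = e'.
Proof.
  destruct half_power_graph as (h & Hf & _ & Hg); rewrite !Hg.
  exact (family_unique HZF (proj1 Hf)).
Qed.

Lemma half_power_omega n e : is_half_power R n e -> n ∈ w.
Proof.
  destruct half_power_graph as (h & Hf & _ & Hg); rewrite Hg.
  exact (family_dom HZF (proj1 Hf)).
Qed.

Lemma half_power_succ n s x y :
  is_succ s n -> is_half_power R n x -> is_half_power R s y -> add y y x.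
Proof.
  destruct half_power_graph as (h & Hf & [_ HS] & Hg); rewrite !Hg; eauto.
Qed.

Lemma half_power_pos n e : is_half_power R n e -> lt (Rzero R) e.
Proof.
  intros He; pose proof (half_power_omega He) as Hn; revert e He.
  destruct half_power_graph as (h & Hf & [H0 HS] & Hg).
  setoid_rewrite Hg; pattern n; revert n Hn; apply (omega_ind HZF Hw).
  - solve_definable.
  - intros z Hz e He; rewrite (family_unique HZF (proj1 Hf) He (H0 z Hz)).
    apply (zero_lt_one HZF).
  - intros n s Hn IH Hs e He.
    destruct (family_total (proj1 Hf) Hn) as [x Hx].
    apply (half_pos HZF (HS _ _ _ _ Hs Hx He) (IH x Hx)).
Qed.

Lemma half_power_decreasing n m x y :
  m ∈ n -> is_half_power R m x -> is_half_power R n y -> lt y x.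
Proof.
  intros Hmn Hx Hy; pose proof (half_power_omega Hy) as Hn.
  revert y Hmn Hy; destruct half_power_graph as (h & Hf & _ & Hg).
  setoid_rewrite Hg; apply Hg in Hx; pattern n; revert n Hn.
  apply (omega_ind HZF Hw).
  - solve_definable.
  - intros z Hz y Hm; destruct (Hz m Hm).
  - intros n s Hn IH Hs y Hm Hy.
    destruct (family_total (proj1 Hf) Hn) as [e He].
    assert (Hye : lt y e).
    { apply Hg in He; apply Hg in Hy.
      apply (half_pos HZF (half_power_succ Hs He Hy) (half_power_pos He)). }
    apply Hs in Hm; destruct Hm as [Hm | ->].
    + apply (lt_le_trans Hye), IH; auto.
    + rewrite (family_unique HZF (proj1 Hf) Hx He); auto.
Qed.

End HalfPowers.

(** * Quasi-metrics *)

Section QuasiMetrics.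
Context {V : structure} (HZF : ZF V) (w : V) (Hw : is_omega w).
Context (R : real_line V).
Implicit Types d e m n r s x y z X T U W : V.

Local Notation lt := (Rlt R).

Definition ball d n x y : Prop :=
  exists e r, is_half_power R n e /\ app2 d x y r /\ lt r e.

Lemma induced_topology_iff d X T :
  is_induced_topology R d X T <->
  forall W, W ∈ T <->
    subset W X /\
    forall x, x ∈ W -> exists n, n ∈ w /\ forall y, ball d n x y -> y ∈ W.
Proof.
  assert (H : forall W,
    (forall x, x ∈ W -> exists w' n e, is_omega w' /\ n ∈ w' /\
       is_half_power R n e /\ forall y r, app2 d x y r -> lt r e -> y ∈ W) <->
    (forall x, x ∈ W -> exists n, n ∈ w /\ forall y, ball d n x y -> y ∈ W)).
  { intros W; split; intros H x Hx; specialize (H x Hx).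
    - destruct H as (w' & n & e & Hw' & Hn & He & H); exists n.
      rewrite (omega_unique HZF Hw Hw') in Hn; split; auto.
      intros y (e' & r & He' & Hr & Hlt).
      rewrite (half_power_unique HZF Hw He' He) in Hlt; eauto.
    - destruct H as (n & Hn & H).
      destruct (half_power_exists HZF Hw R Hn) as [e He].
      exists w, n, e; repeat (split; auto); intros y r Hr Hlt.
      apply H; exists e, r; auto. }
  unfold is_induced_topology; split; intros HT W; rewrite (HT W), H; tauto.
Qed.

(** * First countability of quasi-metrizable spaces *)

Section FirstCountability.
Context d X T (Hd : is_quasi_metric R d X) (HT : is_induced_topology R d X T).

Lemma ball_points n x y : ball d n x y -> x ∈ X /\ y ∈ X.
Proof.
  destruct Hd as ((XX & Hc & Hf) & _); intros (e & r & _ & Hr & _).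
  destruct (fun2_dom HZF Hc Hf Hr) as (Hx & Hy & _); auto.
Qed.

Lemma ball_center n x : n ∈ w -> x ∈ X -> ball d n x x.
Proof.
  destruct Hd as (_ & _ & H0 & _); intros Hn Hx.
  destruct (half_power_exists HZF Hw R Hn) as [e He].
  exists e, (Rzero R); split; [|split]; auto.
  apply (half_power_pos HZF Hw He).
Qed.

Lemma ball_add n s x y z :
  is_succ s n -> ball d s x y -> ball d s y z -> ball d n x z.
Proof.
  intros Hs Hxy Hyz.
  destruct (ball_points Hxy) as [Hx Hy], (ball_points Hyz) as [_ Hz].
  destruct Hd as ((XX & Hc & Hf) & _ & _ & Htri & _).
  destruct Hxy as (e & a & He & Ha & Hae), Hyz as (e' & b & He' & Hb & Hbe).
  rewrite (half_power_unique HZF Hw He' He) in Hbe.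
  assert (Hn : n ∈ w).
  { apply (mem_omega HZF Hw (n := s)); [|apply Hs; auto].
    apply (half_power_omega HZF Hw He). }
  destruct (half_power_exists HZF Hw R Hn) as [u Hu].
  destruct (fun2_total HZF Hc Hf Hx Hz) as (r & _ & Hr).
  destruct (fun2_dom HZF Hc Hf Ha) as (_ & _ & Ra).
  destruct (fun2_dom HZF Hc Hf Hb) as (_ & _ & Rb).
  destruct (add_total HZF Ra Rb) as (t & _ & Ht).
  exists u, r; split; [|split]; auto.
  apply (le_lt_trans (y := t)); [exact (Htri _ _ _ _ _ _ _ Hr Ha Hb Ht)|].
  apply (lt_add HZF Hae Hbe Ht (half_power_succ HZF Hw Hs Hu He)).
Qed.

(** Interiors of the balls around a point form a countable base: with
    [2^-(n+1) + 2^-(n+1) = 2^-n] one sees that they are open without using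
    that [2^-n] tends to [0]. *)
Lemma quasi_metric_first_countable : first_countable X T.
Proof.
  rewrite induced_topology_iff in HT; intros x Hx.
  set (interior := fun n y =>
    y ∈ X /\ exists m, m ∈ w /\ forall z, ball d m y z -> ball d n x z).
  assert (Hdef : definable2 interior)
    by (unfold interior, ball; solve_definable).
  destruct (power_set HZF X) as [q Hq].
  destruct (separate HZF
    (P := fun U => exists n, n ∈ w /\ forall y, y ∈ U <-> interior n y))
    with q as [B HB]; [solve_definable|].
  exists B; repeat split.
  - apply (countable_intro HZF Hw (P := fun U n => forall y, y ∈ U <-> interior n y)).
    + solve_definable.
    + intros U HU; apply HB, HU.
    + intros U U' n _ _ _ H H'; apply (ext HZF); intros y.
      rewrite (H y), (H' y); tauto.
  - intros U HU; apply HB in HU; destruct HU as (_ & n & Hn & HU).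
    apply HT; split; [intros y Hy; apply HU in Hy; apply Hy|].
    intros y Hy; apply HU in Hy; destruct Hy as (Hy & m & Hm & H).
    (* The radius [2^-(m+1)] is used twice: if [z] is that close to [y], then the ball of the same
       radius around [z] lies in the ball of radius [2^-m] around [y], so [z] is interior as
       well. *)
    destruct (succ_exists HZF m) as [s Hs].
    pose proof (succ_in HZF Hw Hm Hs) as Hsw.
    exists s; split; auto; intros z Hz; apply HU; split;
      [apply (ball_points Hz)|].
    exists s; split; auto; intros v Hv; apply H; eapply ball_add; eauto.
  - intros U HU; apply HB in HU; destruct HU as (_ & n & Hn & HU).
    apply HU; split; eauto.
  - intros W HW HxW; destruct (proj1 (HT W) HW) as [HWX H].
    destruct (H x HxW) as (n & Hn & Hball).
    destruct (separate HZF (P := interior n)) with X as [U HU];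
      [solve_definable|].
    assert (HU' : forall y, y ∈ U <-> interior n y)
      by (intros y; rewrite (HU y); unfold interior; tauto).
    exists U; split.
    + apply HB; split; [|eauto]; apply Hq; intros y Hy; apply HU in Hy; tauto.
    + intros y Hy; apply HU' in Hy; destruct Hy as (Hy & m & Hm & H').
      apply Hball, H', ball_center; auto.
Qed.

End FirstCountability.

(** * Metrics from decreasing sequences of equivalence relations *)

Section EquivalenceRelations.
Context X T (E : V -> V -> V -> Prop) (HE : definable3 E).
Context
  (E_refl : forall n x, x ∈ X -> E n x x)
  (E_sym : forall n x y, E n x y -> E n y x)
  (E_trans : forall n x y z, y ∈ X -> E n x y -> E n y z -> E n x z)
  (E_anti : forall n m x y, n ∈ w -> m ∈ n -> E n x y -> E m x y)
  (E_sep : forall x y, x ∈ X -> y ∈ X -> (forall n, n ∈ w -> E n x y) -> x = y)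
  (HT : forall W, W ∈ T <-> subset W X /\
     forall x, x ∈ W ->
       exists n, n ∈ w /\ forall y, y ∈ X -> E n x y -> y ∈ W).

Let first_split n x y : Prop :=
  n ∈ w /\ ~ E n x y /\ forall m, m ∈ n -> E m x y.

Let dist x y r : Prop :=
  (x = y /\ r = Rzero R) \/
  exists n, first_split n x y /\ is_half_power R n r.

Lemma first_split_exists x y :
  x ∈ X -> y ∈ X -> x <> y -> exists n, first_split n x y.
Proof.
  intros Hx Hy Hne; apply NNPP; intros H; apply Hne, E_sep; auto.
  intros n Hn; apply NNPP; intros HnE.
  destruct (omega_least HZF Hw (P := fun n => ~ E n x y)) with n
    as (m & Hm & HmE & Hmin); auto; [solve_definable|].
  apply H; exists m; repeat split; auto.
  intros k Hk; apply NNPP; exact (Hmin k Hk).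
Qed.

Lemma first_split_le n m x y :
  first_split n x y -> m ∈ w -> ~ E m x y -> n ∈ m \/ n = m.
Proof.
  intros (Hn & Hne & H) Hm HmE.
  destruct (omega_trichotomy HZF Hw Hn Hm) as [Hmn | [-> | Hnm]]; auto.
  destruct (HmE (H m Hmn)).
Qed.

Lemma first_split_unique n m x y :
  first_split n x y -> first_split m x y -> n = m.
Proof.
  intros Hn Hm.
  destruct (first_split_le (m := m) Hn) as [H | H]; auto; try apply Hm.
  destruct Hn as (_ & Hn & _); destruct Hn; apply Hm; auto.
Qed.

Lemma dist_exists_unique x y :
  x ∈ X -> y ∈ X -> exists! r, dist x y r.
Proof.
  intros Hx Hy; destruct (classic (x = y)) as [-> | Hne].
  - exists (Rzero R); split; [left; auto|].
    intros r [[_ ->] | (n & (_ & H & _) & _)]; auto; destruct H; auto.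
  - destruct (first_split_exists Hx Hy Hne) as [n Hn].
    destruct (half_power_exists HZF Hw R (proj1 Hn)) as [r Hr].
    exists r; split; [right; eauto|].
    intros r' [[E1 _] | (m & Hm & Hr')]; [tauto|].
    rewrite (first_split_unique Hm Hn) in Hr'.
    apply (half_power_unique HZF Hw Hr Hr').
Qed.

Lemma dist_nonneg x y r : dist x y r -> app (Rle R) (Rzero R) r.
Proof.
  intros [[_ ->] | (n & _ & Hr)]; [apply Rle_refl, Rzero_in|].
  apply (half_power_pos HZF Hw Hr).
Qed.

Lemma dist_zero x y : dist x y (Rzero R) -> x = y.
Proof.
  intros [[H _] | (n & _ & Hr)]; auto.
  destruct (proj2 (half_power_pos HZF Hw Hr)); auto.
Qed.

Lemma dist_sym x y r : dist x y r -> dist y x r.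
Proof.
  intros [[-> ->] | (n & (Hn & HnE & H) & Hr)]; [left; auto|right].
  exists n; split; auto; repeat split; auto.
Qed.

(** The first split is at most [n], and the powers of one half decrease. Read contrapositively,
    distance below [2^-n] implies [E n]. *)
Lemma dist_le n x y r e :
  x ∈ X -> n ∈ w -> ~ E n x y -> dist x y r -> is_half_power R n e ->
  app (Rle R) e r.
Proof.
  intros Hx Hn HnE [[<- _] | (m & Hm & Hr)] He; [destruct HnE; auto|].
  destruct (first_split_le Hm Hn HnE) as [H | ->].
  - apply (half_power_decreasing HZF Hw H Hr He).
  - rewrite (half_power_unique HZF Hw Hr He).
    apply Rle_refl, (proj2 (le_real HZF (proj1 (half_power_pos HZF Hw He)))).
Qed.

(** The distance is an ultrametric. At the first split [n] of [x] and [y], transitivity of [E n]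
    prevents [z] from being equivalent to both, so one of [b] and [c] is already at least
    [a = 2^-n], and the other is non-negative. *)
Lemma dist_triangle x y z a b c s :
  x ∈ X -> z ∈ X -> dist x y a -> dist x z b -> dist z y c -> app2 (Radd R) b c s ->
  app (Rle R) a s.
Proof.
  intros Hx Hz Ha Hb Hc Hs.
  assert (Hbs : app (Rle R) b s)
    by exact (le_add_nonneg HZF (dist_nonneg Hc) Hs).
  assert (Hcs : app (Rle R) c s)
    by exact (le_add_nonneg HZF (dist_nonneg Hb) (Radd_comm Hs)).
  destruct Ha as [[_ ->] | (n & (Hn & HnE & H) & Ha)].
  - apply (Rle_trans (dist_nonneg Hb) Hbs).
  - destruct (classic (E n x z)) as [Hxz | Hxz].
    + destruct (classic (E n z y)) as [Hzy | Hzy]; [destruct HnE; eauto|].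
      apply (Rle_trans (dist_le Hz Hn Hzy Hc Ha) Hcs).
    + apply (Rle_trans (dist_le Hx Hn Hxz Hb Ha) Hbs).
Qed.

Lemma equivalence_metrizable : metrizable R X T.
Proof.
  destruct (cart_exists HZF X X) as [XX HXX].
  destruct (family_build HZF
    (P := fun p r => exists x y, is_opair p x y /\ dist x y r)) with XX
    as (d & Hd & Hdp).
  { unfold dist, first_split; solve_definable. }
  { intros p Hp; apply HXX in Hp; destruct Hp as (x & y & Hx & Hy & Hp).
    destruct (dist_exists_unique Hx Hy) as (r & Hr & Hu).
    exists r; split; eauto; intros r' (x' & y' & Hp' & Hr').
    destruct (opair_inj HZF Hp Hp') as [-> ->]; auto. }
  assert (Hdist : forall x y r,
            app2 d x y r <-> x ∈ X /\ y ∈ X /\ dist x y r).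
  { intros x y r; split.
    - intros (p & Hp & Hr); apply Hdp in Hr.
      destruct Hr as (Hc & x1 & y1 & Hp1 & Hr); apply HXX in Hc.
      destruct Hc as (x2 & y2 & Hx2 & Hy2 & Hp2).
      destruct (opair_inj HZF Hp Hp1) as [-> ->].
      destruct (opair_inj HZF Hp1 Hp2) as [-> ->]; auto.
    - intros (Hx & Hy & Hr); destruct (opair_exists HZF x y) as [p Hp].
      exists p; split; auto; apply Hdp; split; [apply HXX|]; eauto. }
  exists d; split; [split; [repeat split|]|].
  - exists XX; split; auto; split; auto; intros p r Hr; apply Hdp in Hr.
    destruct Hr as (_ & x & y & _ & [[_ ->] | (n & _ & Hr)]);
      [apply Rzero_in|].
    apply (le_real HZF (proj1 (half_power_pos HZF Hw Hr))).
  - intros x y r Hr; apply Hdist in Hr; eapply dist_nonneg; apply Hr.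
  - intros x Hx; apply Hdist; repeat split; auto; left; auto.
  - intros x y z a b c s Ha Hb Hc.
    apply Hdist in Ha; apply Hdist in Hb; apply Hdist in Hc.
    apply (dist_triangle (x := x) (y := y) (z := z)); tauto.
  - intros x y H; apply Hdist in H; apply dist_zero; tauto.
  - intros x y r H; apply Hdist in H; apply Hdist; repeat split; try tauto.
    apply dist_sym; tauto.
  (* The ball of radius [2^-n] around [x] is exactly its [E n] class: [E n x y] pushes the first
     split strictly beyond [n], and the converse is [dist_le]. *)
  - apply induced_topology_iff; intros W; rewrite (HT W).
    split; intros [HWX H]; split; auto; intros x Hx;
      destruct (H x Hx) as (n & Hn & HW); exists n; split; auto; intros y.
    + intros (e & r & He & Hr & Hlt); apply Hdist in Hr.
      apply HW; [tauto|]; apply NNPP; intros HnE.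
      apply (lt_not_le Hlt), (dist_le (HWX x Hx) Hn HnE); tauto.
    + intros Hy HxyE; apply HW.
      destruct (half_power_exists HZF Hw R Hn) as [e He].
      destruct (dist_exists_unique (HWX x Hx) Hy) as (r & Hr & _).
      exists e, r; split; [|split]; auto; [apply Hdist; auto|].
      destruct Hr as [[_ ->] | (m & (Hm & HmE & _) & Hr)];
        [apply (half_power_pos HZF Hw He)|].
      apply (half_power_decreasing HZF Hw (n := m) (m := n)); auto.
      destruct (omega_trichotomy HZF Hw Hn Hm) as [Hmn | [-> | Hnm]]; auto.
      * destruct (HmE (E_anti Hn Hmn HxyE)).
      * destruct (HmE HxyE).
Qed.

End EquivalenceRelations.
End QuasiMetrics.

(** * Products of compactifications *)

Section OnePointCompactification.
Context {V : structure} (HZF : ZF V) (w : V) (Hw : is_omega w).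
Implicit Types X Y T U C oo z : V.

(** The discrete space is eliminated from [is_one_point_compactification]: only the factor and its
    topology remain, so the points at infinity of all factors are given by one formula. *)
Definition point_at_infinity Y T oo : Prop :=
  oo ∈ Y /\ forall U, U ∈ T <-> subset U Y /\
    (oo ∈ U -> exists C, is_diff C Y U /\ finite_set C).

Lemma compactification_point X Y T :
  denumerable X -> is_one_point_compactification X Y T ->
  ~ finite_set Y /\ exists oo, point_at_infinity Y T oo.
Proof.
  intros HX (oo & Hoo & HY & HT); split.
  - intros HYf; apply (denumerable_not_finite HZF Hw HX).
    apply (finite_subset HZF Hw HYf); intros z Hz; apply HY; auto.
  - exists oo; split; auto; apply HY; auto.
Qed.

Lemma cofinite_open Y T oo U :
  point_at_infinity Y T oo -> subset U Y ->
  (oo ∈ U -> forall C, is_diff C Y U -> finite_set C) -> U ∈ T.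
Proof.
  intros [_ H] HU HC; apply H; split; auto; intros Hoo.
  destruct (separate HZF (P := fun z => z ∉ U)) with Y as [C HCd];
    [solve_definable|].
  exists C; split; auto.
Qed.

Lemma singleton_open Y T oo U x :
  point_at_infinity Y T oo -> x ∈ Y -> x <> oo -> (forall z, z ∈ U <-> z = x) ->
  U ∈ T.
Proof.
  intros H Hx Hne HU; apply (cofinite_open H).
  - intros z Hz; apply HU in Hz; subst; auto.
  - intros Hoo; apply HU in Hoo; congruence.
Qed.

Lemma punctured_open Y T oo U x :
  point_at_infinity Y T oo -> (forall z, z ∈ U <-> z ∈ Y /\ z <> x) -> U ∈ T.
Proof.
  intros H HU; apply (cofinite_open H).
  - intros z Hz; apply HU in Hz; tauto.
  - intros _ C HC; apply (finite_singleton HZF Hw (x := x)).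
    intros z Hz; apply HC in Hz; rewrite HU in Hz; apply NNPP; tauto.
Qed.

(** If the two points differed, [{oo}] would be open as a set missing [oo'], hence cofinite as an
    open set containing [oo], and the factor would be finite. *)
Lemma point_at_infinity_unique Y T oo oo' :
  ~ finite_set Y -> point_at_infinity Y T oo -> point_at_infinity Y T oo' ->
  oo = oo'.
Proof.
  intros HY H H'; apply NNPP; intros Hne; apply HY.
  destruct (pairing HZF oo oo) as [U HU].
  assert (HU' : forall z, z ∈ U <-> z = oo) by (intros z; rewrite (HU z); tauto).
  assert (HUT : U ∈ T) by exact (singleton_open H' (proj1 H) Hne HU').
  destruct (proj2 (proj1 (proj2 H U) HUT)) as (C & HC & HCf);
    [apply HU'; auto|].
  apply (finite_adjoin HZF Hw HCf (x := oo)).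
  intros z; rewrite (HC z), HU'; split.
  - intros Hz; destruct (classic (z = oo)); auto.
  - intros [[Hz _] | ->]; auto; apply H.
Qed.

End OnePointCompactification.

(** * Boxes and projections in the product *)

Section Product.
Context {V : structure} (HZF : ZF V) (w : V) (Hw : is_omega w).
Context (J Y T P TP : V).
Context (HY : is_family Y J) (HT : is_family T J).
Context (HP : is_product P J Y) (HTP : is_product_topology J Y T P TP).
Context (o : V) (Ho : is_family o J).
Context (Hoo : forall j oo y t,
  app o j oo -> app Y j y -> app T j t -> point_at_infinity y t oo).
Implicit Types f g h j k m n t u x y z U W F C : V.

Lemma infinity_in_product : o ∈ P.
Proof.
  apply HP; split; auto; intros j oo y H Hy.
  destruct (family_total HT (family_dom HZF Ho H)) as [t Ht].
  apply (Hoo H Hy Ht).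
Qed.

Lemma modify_point f j y z :
  f ∈ P -> app Y j y -> z ∈ y ->
  exists g, g ∈ P /\ app g j z /\
    forall k x, app g k x -> (k = j /\ x = z) \/ app f k x.
Proof.
  intros Hf Hy Hz; apply HP in Hf; destruct Hf as [Hf HfY].
  destruct (family_build HZF
    (P := fun k x => (k = j /\ x = z) \/ (k <> j /\ app f k x))) with J
    as (g & Hg & Hgk).
  - solve_definable.
  - intros k Hk; destruct (classic (k = j)) as [-> | Hne].
    + exists z; split; auto; intros x [[_ ->] | [H _]]; tauto.
    + destruct (family_total Hf Hk) as [x Hx]; exists x; split; auto.
      intros x' [[H _] | [_ Hx']]; [tauto|].
      exact (family_unique HZF Hf Hx Hx').
  - exists g; split; [apply HP; split; auto|split].
    + intros k x u Hx Hu; apply Hgk in Hx.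
      destruct Hx as [_ [[-> ->] | [_ Hx]]]; eauto.
      rewrite (family_unique HZF HY Hu Hy); auto.
    + apply Hgk; split; [apply (family_dom HZF HY Hy)|auto].
    + intros k x Hx; apply Hgk in Hx; tauto.
Qed.

(** A box is described by a definable condition on each coordinate. The sides are then unique, so
    replacement yields their family. *)
Lemma box_basic_open (Q : V -> V -> Prop) (HQ : definable2 Q) F W :
  (forall j y t u, app Y j y -> app T j t ->
     (forall z, z ∈ u <-> z ∈ y /\ Q j z) -> u ∈ t) ->
  finite_set F -> subset F J ->
  (forall j y z, j ∉ F -> app Y j y -> z ∈ y -> Q j z) ->
  (forall f, f ∈ W <-> f ∈ P /\ forall j x, app f j x -> Q j x) ->
  is_basic_open J Y T W.
Proof.
  intros Hopen HF HFJ HQF HW.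
  destruct (family_build HZF
    (P := fun j u => exists y, app Y j y /\ forall z, z ∈ u <-> z ∈ y /\ Q j z))
    with J as (U & HU & HUj).
  { solve_definable. }
  { intros j Hj; destruct (family_total HY Hj) as [y Hy].
    destruct (separate HZF (P := Q j)) with y as [u Hu]; [solve_definable|].
    exists u; split; eauto; intros u' (y' & Hy' & Hu').
    rewrite (family_unique HZF HY Hy' Hy) in Hu'.
    apply (ext HZF); intros z; rewrite Hu, Hu'; tauto. }
  exists U, F; split; [auto|split; [|split; [auto|split; [auto|split]]]].
  - intros j u t Hu Ht; apply HUj in Hu; destruct Hu as (_ & y & Hy & Hu); eauto.
  - intros j u y Hj Hu Hy; apply HUj in Hu; destruct Hu as (_ & y' & Hy' & Hu).
    rewrite (family_unique HZF HY Hy' Hy) in Hu.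
    apply (ext HZF); intros z; rewrite Hu; split; [tauto|eauto].
  - intros f; rewrite HW, (HP f); split.
    + intros [[Hf HfY] HfQ]; split; auto; intros j x u Hx Hu.
      apply HUj in Hu; destruct Hu as (_ & y & Hy & Hu); apply Hu; eauto.
    + intros [Hf HfU].
      assert (H : forall j x y, app f j x -> app Y j y -> x ∈ y /\ Q j x).
      { intros j x y Hx Hy.
        destruct (family_total HU (family_dom HZF Hf Hx)) as [u Hu].
        pose proof (HfU j x u Hx Hu) as H; apply HUj in Hu.
        destruct Hu as (_ & y' & Hy' & Hu).
        rewrite (family_unique HZF HY Hy' Hy) in Hu; apply Hu; auto. }
      split; [split; auto|].
      * intros j x y Hx Hy; apply (H j x y Hx Hy).
      * intros j x Hx.
        destruct (family_total HY (family_dom HZF Hf Hx)) as [y Hy].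
        apply (H j x y Hx Hy).
Qed.

Lemma preimage_open j t u W :
  app T j t -> u ∈ t ->
  (forall f, f ∈ W <-> f ∈ P /\ forall x, app f j x -> x ∈ u) -> W ∈ TP.
Proof.
  intros Ht Hu HW; apply HTP; split; [intros f Hf; apply HW, Hf|].
  intros f Hf; exists W; split; [|split; auto; intros g; auto].
  pose proof (family_dom HZF HT Ht) as Hj.
  destruct (pairing HZF j j) as [F HF].
  apply (box_basic_open (Q := fun k z => k = j -> z ∈ u)) with F.
  - solve_definable.
  - intros k y t' u' Hy Ht' Hu'.
    destruct (family_total Ho (family_dom HZF HT Ht')) as [oo Hk].
    pose proof (Hoo Hk Hy Ht') as Hinf.
    destruct (classic (k = j)) as [-> | Hne].
    + rewrite (family_unique HZF HT Ht' Ht) in *.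
      rewrite (ext HZF (a := u') (b := u)); auto; intros z; rewrite Hu'.
      apply (proj2 Hinf) in Hu; destruct Hu as [Hu _]; split; auto; tauto.
    (* Away from [j] the side is the whole factor, whose complement is empty. *)
    + apply (cofinite_open HZF Hinf); [intros z Hz; apply Hu', Hz|].
      intros _ C HC; apply (finite_empty HZF Hw); intros z Hz.
      apply HC in Hz; rewrite Hu' in Hz; tauto.
  - apply (finite_singleton HZF Hw (x := j)); intros z Hz; apply HF in Hz; tauto.
  - intros z Hz; apply HF in Hz; destruct Hz; subst; auto.
  - intros k y z Hk _ _ ->; destruct Hk; apply HF; auto.
  - intros g; rewrite HW; split; intros [Hg H]; split; auto.
    + intros k x Hx ->; auto.
    + intros x Hx; apply (H j x Hx eq_refl).
Qed.

(** A box around [o] inside [U] has a [j]-th side that is open and contains the point at infinity,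
    hence is cofinite. Every [z] in this side lies in the projection of [U]: changing the [j]-th
    coordinate of [o] to [z] does not leave the box. *)
Lemma projection_cofinite U j y C :
  U ∈ TP -> o ∈ U -> app Y j y ->
  (forall z, z ∈ C -> z ∈ y /\ ~ exists h, h ∈ U /\ app h j z) ->
  finite_set C.
Proof.
  intros HU HoU Hy HC.
  destruct (proj2 (proj1 (HTP U) HU) o HoU) as (B & HB & HoB & HBU).
  destruct HB as (u_ & F & Hu_ & HuT & _ & _ & _ & HB).
  pose proof (family_dom HZF HY Hy) as Hj.
  destruct (family_total Hu_ Hj) as [u Hu].
  destruct (family_total HT Hj) as [t Ht].
  destruct (family_total Ho Hj) as [oo Hojoo].
  pose proof (proj1 (HB o) HoB) as [_ HoB'].
  destruct (proj1 (proj2 (Hoo Hojoo Hy Ht) u)) as [_ (D & HD & HDf)]; eauto.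
  apply (finite_subset HZF Hw HDf); intros z Hz.
  destruct (HC z Hz) as [Hzy Hn]; apply HD; split; auto; intros Hzu.
  destruct (modify_point infinity_in_product Hy Hzy) as (g & Hg & Hgj & Hgk).
  apply Hn; exists g; split; auto; apply HBU, HB.
  split; [apply HP, Hg|]; intros k x v Hx Hv.
  destruct (Hgk k x Hx) as [[-> ->] | Hx']; eauto.
  rewrite (family_unique HZF Hu_ Hv Hu); auto.
Qed.

(** * The closeness relations defined by a countable base at infinity *)

Context (i : V) (Hi : is_fun i J w).
Context (Hi_inj : forall j j' k, app i j k -> app i j' k -> j = j').
Context (B : V) (HBT : subset B TP) (HBo : forall U, U ∈ B -> o ∈ U).
Context (HBbase : forall W, W ∈ TP -> o ∈ W -> exists U, U ∈ B /\ subset U W).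
Context (b : V) (Hb : is_fun b B w).
Context (Hb_inj : forall U U' k, app b U k -> app b U' k -> U = U').

(** [near j n] is the trace on the [j]-th factor of the first [n] members of
    the base at infinity. *)
Let near j n z : Prop :=
  forall U k, app b U k -> k ∈ n -> exists h, h ∈ U /\ app h j z.

(** The [n]-closeness of the overview. The first [n] factors are those whose value under the
    injection [i] is below [n]; there may be fewer than [n] of them. *)
Let agree n f g : Prop :=
  forall j k x y, app i j k -> k ∈ n -> app f j x -> app g j y ->
    x = y \/ (near j n x /\ near j n y).

Lemma definable_near : definable3 near.
Proof. unfold near; solve_definable. Qed.

Lemma near_infinity j n oo : app o j oo -> near j n oo.
Proof.
  intros H U k Hk _; exists o; split; auto; apply HBo.
  exact (family_dom HZF (proj1 Hb) Hk).
Qed.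

Lemma near_anti j n m z : n ∈ w -> m ∈ n -> near j n z -> near j m z.
Proof.
  intros Hn Hm H U k Hk Hkm; apply (H U k); auto.
  apply (mem_trans HZF Hw Hn Hm Hkm).
Qed.

(** Induction on [n]: the step brings in at most one further trace, that of the base member numbered
    [n], and it excludes finitely many points by [projection_cofinite]. As [b] need not be onto [ω],
    there may be no such member, and then no new point is excluded. *)
Lemma far_finite n j y C :
  n ∈ w -> app Y j y -> (forall z, z ∈ C -> z ∈ y /\ ~ near j n z) ->
  finite_set C.
Proof.
  intros Hn Hy; revert C; pattern n; revert n Hn.
  pose proof definable_near as Hdef.
  apply (omega_ind HZF Hw).
  - solve_definable.
  - intros n Hn C HC; apply (finite_empty HZF Hw); intros z Hz.
    apply HC in Hz; apply (proj2 Hz); intros U k _ Hk; destruct (Hn k Hk).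
  - intros n s Hn IH Hs C HC.
    destruct (separate HZF (P := fun z => ~ near j n z)) with C as [C1 HC1];
      [solve_definable|].
    destruct (separate HZF (P := near j n)) with C as [C2 HC2];
      [solve_definable|].
    apply (finite_union HZF Hw (a := C1) (b := C2)).
    + apply IH; intros z Hz; apply HC1 in Hz; split; [apply HC|]; tauto.
    + destruct (classic (exists U, app b U n)) as [[U HU] | H].
      * pose proof (family_dom HZF (proj1 Hb) HU) as HUB.
        apply (projection_cofinite (HBT HUB) (HBo HUB) Hy).
        intros z Hz; apply HC2 in Hz; destruct Hz as [Hz Hnear].
        destruct (HC z Hz) as [Hzy Hfar]; split; auto; intros Hh.
        apply Hfar; intros U' k Hk Hks; apply Hs in Hks.
        destruct Hks as [Hkn | ->]; [apply (Hnear U' k); auto|].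
        rewrite (Hb_inj Hk HU); auto.
      * apply (finite_empty HZF Hw); intros z Hz; apply HC2 in Hz.
        destruct Hz as [Hz Hnear]; apply (proj2 (HC z Hz)).
        intros U k Hk Hks; apply Hs in Hks.
        destruct Hks as [Hkn | ->]; [apply (Hnear U k); auto|].
        destruct H; eauto.
    + intros z Hz; rewrite HC1, HC2; destruct (classic (near j n z)); auto.
Qed.

(** The traces shrink to infinity: the preimage of [u] under the [j]-th projection is an open
    neighbourhood of [o], so it contains a base member, and the trace of that member lies in [u].
    Take for [k] the number of this member. *)
Lemma near_base j t u oo :
  app T j t -> app o j oo -> u ∈ t -> oo ∈ u ->
  exists k, k ∈ w /\ forall n z, k ∈ n -> near j n z -> z ∈ u.
Proof.
  intros Ht Hj Hu Hou.
  destruct (separate HZF (P := fun f => forall x, app f j x -> x ∈ u)) with P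
    as [W HW]; [solve_definable|].
  destruct (HBbase (W := W)) as (U & HU & HUW).
  - apply (preimage_open Ht Hu HW).
  - apply HW; split; [apply infinity_in_product|]; intros x Hx.
    rewrite (family_unique HZF Ho Hx Hj); auto.
  - destruct (family_total (proj1 Hb) HU) as [k Hk].
    exists k; split; [apply (proj2 Hb _ _ Hk)|]; intros n z Hkn Hz.
    destruct (Hz U k Hk Hkn) as (h & Hh & Hhz); apply HUW, HW in Hh.
    apply (proj2 Hh); auto.
Qed.

(** The factor without [x] is an open neighbourhood of infinity, so [near_base] applies to it. *)
Lemma far_eventually j y oo x :
  app Y j y -> app o j oo -> x ∈ y -> x <> oo ->
  exists k, k ∈ w /\ forall n, k ∈ n -> ~ near j n x.
Proof.
  intros Hy Hj Hx Hne.
  destruct (family_total HT (family_dom HZF HY Hy)) as [t Ht].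
  destruct (separate HZF (P := fun z => z <> x)) with y as [u Hu];
    [solve_definable|].
  pose proof (Hoo Hj Hy Ht) as Hinf.
  destruct (near_base Ht Hj (punctured_open HZF Hw Hinf Hu)) as (k & Hk & H).
  - apply Hu; split; [apply Hinf|auto].
  - exists k; split; auto; intros n Hn Hnear.
    apply (H n x Hn), Hu in Hnear; tauto.
Qed.

(** Within a single factor the classes form a base. At infinity they are the shrinking traces; any
    other point eventually leaves the traces, and its class becomes a singleton. *)
Lemma agree_base j t u x :
  app T j t -> u ∈ t -> x ∈ u ->
  exists k, k ∈ w /\ forall n z, k ∈ n ->
    x = z \/ (near j n x /\ near j n z) -> z ∈ u.
Proof.
  intros Ht Hu Hx; pose proof (family_dom HZF HT Ht) as Hj.
  destruct (family_total HY Hj) as [y Hy], (family_total Ho Hj) as [oo Hojoo].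
  destruct (classic (x = oo)) as [-> | Hne].
  - destruct (near_base Ht Hojoo Hu Hx) as (k & Hk & H).
    exists k; split; auto; intros n z Hn [<- | [_ Hz]]; eauto.
  - destruct (@far_eventually j y oo x) as (k & Hk & H); auto.
    + apply (proj2 (Hoo Hojoo Hy Ht)) in Hu; apply Hu, Hx.
    + exists k; split; auto; intros n z Hn [<- | [Hz _]]; auto.
      destruct (H n Hn Hz).
Qed.

Lemma agree_refl n f : f ∈ P -> agree n f f.
Proof.
  intros Hf j k x y _ _ Hx Hy; left.
  apply HP in Hf; exact (family_unique HZF (proj1 Hf) Hx Hy).
Qed.

Lemma agree_sym n f g : agree n f g -> agree n g f.
Proof.
  intros H j k x y Hk Hkn Hx Hy.
  destruct (H j k y x Hk Hkn Hy Hx) as [-> | [? ?]]; auto.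
Qed.

Lemma agree_trans n f g h : g ∈ P -> agree n f g -> agree n g h -> agree n f h.
Proof.
  intros Hg Hfg Hgh j k x z Hk Hkn Hx Hz; apply HP in Hg.
  destruct (family_total (proj1 Hg) (family_dom HZF (proj1 Hi) Hk)) as [y Hy].
  destruct (Hfg j k x y Hk Hkn Hx Hy) as [-> | [? ?]],
    (Hgh j k y z Hk Hkn Hy Hz) as [-> | [? ?]]; auto.
Qed.

Lemma agree_anti n m f g : n ∈ w -> m ∈ n -> agree n f g -> agree m f g.
Proof.
  intros Hn Hm H j k x y Hk Hkm Hx Hy.
  destruct (H j k x y) as [-> | [? ?]]; auto.
  - apply (mem_trans HZF Hw Hn Hm Hkm).
  - right; split; eapply near_anti; eauto.
Qed.

Lemma agree_separated f g :
  f ∈ P -> g ∈ P -> (forall n, n ∈ w -> agree n f g) -> f = g.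
Proof.
  intros Hf Hg H; apply HP in Hf; apply HP in Hg.
  destruct Hf as [Hf HfY], Hg as [Hg HgY].
  apply (family_ext HZF Hf Hg); intros j x Hx.
  pose proof (family_dom HZF Hf Hx) as Hj.
  destruct (family_total Hg Hj) as [x' Hx'].
  destruct (classic (x = x')) as [-> | Hne]; auto.
  destruct (family_total HY Hj) as [y Hy], (family_total Ho Hj) as [oo Hojoo].
  (* Of two distinct values at least one is not at infinity, and that one is eventually far, so from
     then on the two values are not both near. *)
  assert (Hfar : exists k, k ∈ w /\
            forall n, k ∈ n -> ~ (near j n x /\ near j n x')).
  { destruct (classic (x = oo)) as [-> | Hxo].
    - destruct (@far_eventually j y oo x') as (k & Hk & Hn); eauto.
      exists k; split; auto; intros n Hkn [_ ?]; eapply Hn; eauto.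
    - destruct (@far_eventually j y oo x) as (k & Hk & Hn); eauto.
      exists k; split; auto; intros n Hkn [? _]; eapply Hn; eauto. }
  destruct Hfar as (k & Hk & Hfar).
  destruct (family_total (proj1 Hi) Hj) as [l Hl].
  destruct (omega_bound2 HZF Hw Hk (proj2 Hi _ _ Hl)) as (n & Hn & Hkn & Hln).
  destruct (H n Hn j l x x' Hl Hln Hx Hx') as [E | E]; [congruence|].
  destruct (Hfar n Hkn E).
Qed.

(** Closeness to [f] is a condition on each coordinate separately, so the class is a box. It
    restricts only the factors numbered below [n], and these are finitely many because [i] is
    injective. *)
Lemma agree_class_basic_open n f W :
  n ∈ w -> f ∈ P -> (forall g, g ∈ W <-> g ∈ P /\ agree n f g) ->
  is_basic_open J Y T W.
Proof.
  intros Hn Hf HW; pose proof (proj1 (HP f) Hf) as [Hff HfY].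
  pose proof definable_near as Hdef.
  destruct (separate HZF (P := fun j => exists k, k ∈ n /\ app i j k)) with J
    as [F HF]; [solve_definable|].
  apply (box_basic_open (Q := fun j z => forall k x, app i j k -> k ∈ n ->
           app f j x -> x = z \/ (near j n x /\ near j n z))) with F.
  - solve_definable.
  - intros j y t u Hy Ht Hu; pose proof (family_dom HZF HY Hy) as Hj.
    destruct (family_total Ho Hj) as [oo Hojoo].
    apply (cofinite_open HZF (Hoo Hojoo Hy Ht)); [intros z Hz; apply Hu, Hz|].
    (* Only a side containing infinity has to be checked. There the value of [f], if restricted at
       all, is near, being infinity itself or near by the closeness condition. The side then
       contains every near point, so its complement consists of far points. *)
    intros Hou C HC; apply (far_finite Hn Hy); intros z Hz.
    apply HC in Hz; destruct Hz as [Hzy Hzu]; split; auto; intros Hnear.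
    apply Hzu, Hu; split; auto; intros k x Hk Hkn Hx; right; split; auto.
    apply Hu in Hou; destruct (proj2 Hou k x) as [-> | [? _]]; auto.
    apply near_infinity; auto.
  - apply (@finite_of_injection V HZF w Hw (app i)) with n; auto.
    + solve_definable.
    + intros j Hj; apply HF in Hj; tauto.
  - intros j Hj; apply HF in Hj; tauto.
  - intros j y z Hj Hy _ k x Hk Hkn; destruct Hj; apply HF.
    split; eauto; exact (family_dom HZF HY Hy).
  - intros g; rewrite HW; split; intros [Hg H]; split; auto.
    + intros j z Hz k x Hk Hkn Hx; eapply H; eauto.
    + intros j k x z Hk Hkn Hx Hz; eapply H; eauto.
Qed.

Lemma agree_topology W :
  W ∈ TP <-> subset W P /\
    forall f, f ∈ W ->
      exists n, n ∈ w /\ forall g, g ∈ P -> agree n f g -> g ∈ W.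
Proof.
  pose proof definable_near as Hdef.
  rewrite (HTP W); split; intros [HWP H]; split; auto; intros f Hf.
  - destruct (H f Hf) as (A & (u_ & F & Hu_ & HuT & HF & HFJ & HuY & HA) & HfA
                            & HAW).
    pose proof (proj1 (HP f) (HWP f Hf)) as [Hff _].
    pose proof (proj1 (HA f) HfA) as [_ HfA'].
    (* One [n] has to serve all coordinates in [F]. It must exceed the number of [j], so that
       [agree n] says something about this coordinate, and be large enough that closeness to the
       value of [f] forces membership in the [j]-th side. *)
    destruct (finite_bound HZF Hw (P := fun j n => (exists k, app i j k /\ k ∈ n) /\
      forall x u z, app f j x -> app u_ j u ->
        x = z \/ (near j n x /\ near j n z) -> z ∈ u)) with F
      as (n & Hn & HFn); auto.
    + solve_definable.
    + intros j n m [(k & Hk & Hkm) Hm] Hn Hmn; split.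
      * exists k; split; auto; apply (mem_trans HZF Hw Hn Hmn Hkm).
      * intros x u z Hx Hu Hxz; apply (Hm x u z Hx Hu).
        destruct Hxz as [-> | [? ?]]; auto.
        right; split; eapply near_anti; eauto.
    + intros j Hj; apply HFJ in Hj.
      destruct (family_total HT Hj) as [t Ht], (family_total Hff Hj) as [x Hx].
      destruct (family_total Hu_ Hj) as [u Hu].
      destruct (@agree_base j t u x) as (k & Hk & Hkz); eauto.
      destruct (family_total (proj1 Hi) Hj) as [l Hl].
      destruct (omega_bound2 HZF Hw Hk (proj2 Hi _ _ Hl))
        as (n & Hn & Hkn & Hln).
      exists n; split; auto; split; [eauto|].
      intros x' u' z Hx' Hu'.
      rewrite (family_unique HZF Hff Hx' Hx), (family_unique HZF Hu_ Hu' Hu).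
      eauto.
    + exists n; split; auto; intros g Hg Hfg; apply HAW, HA.
      apply HP in Hg; split; [apply Hg|]; intros j z u Hz Hu.
      destruct (classic (j ∈ F)) as [Hj | Hj].
      * destruct (HFn j Hj) as [(k & Hk & Hkn) HFj].
        destruct (family_total Hff (HFJ j Hj)) as [x Hx].
        apply (HFj x u z); eauto.
      * destruct (family_total HY (family_dom HZF Hu_ Hu)) as [y Hy].
        rewrite (HuY j u y Hj Hu Hy); apply (proj2 Hg j z y); auto.
  - destruct (H f Hf) as (n & Hn & HnW).
    destruct (separate HZF (P := agree n f)) with P as [A HA];
      [unfold agree; solve_definable|].
    exists A; split; [|split].
    + apply (agree_class_basic_open Hn (HWP f Hf) HA).
    + apply HA; split; auto; apply agree_refl; auto.
    + intros g Hg; apply HA in Hg; apply HnW; tauto.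
Qed.

Lemma product_metrizable (R : real_line V) : metrizable R P TP.
Proof.
  pose proof definable_near as Hdef.
  apply (equivalence_metrizable HZF Hw R (E := agree)).
  - unfold agree; solve_definable.
  - exact agree_refl.
  - exact agree_sym.
  - exact agree_trans.
  - exact agree_anti.
  - exact agree_separated.
  - exact agree_topology.
Qed.

End Product.

Theorem theorem3p33 (V : structure) (HZF : ZF V) (R : real_line V)
  (J Y T P TP : V)
  (HJ : countable_set J) (HJ0 : exists j : V, j ∈ J)
  (HY : is_family Y J) (HT : is_family T J)
  (HYT : forall j y t : V, app Y j y -> app T j t ->
     exists X : V, denumerable X /\ is_one_point_compactification X y t)
  (HP : is_product P J Y) (HTP : is_product_topology J Y T P TP) :
  (first_countable P TP <-> metrizable R P TP) /\
  (first_countable P TP <-> quasi_metrizable R P TP).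
Proof.
  destruct (omega_exists HZF) as [w Hw].
  (* The three properties are connected in a cycle; this is the implication that depends on the
     factors, while the other two hold in every space. *)
  assert (Hfm : first_countable P TP -> metrizable R P TP).
  { intros Hfc.
    destruct (family_build HZF (P := fun j oo => exists y t,
      app Y j y /\ app T j t /\ point_at_infinity y t oo)) with J
      as (o & Ho & Hoj).
    { unfold point_at_infinity; solve_definable. }
    { intros j Hj.
      destruct (family_total HY Hj) as [y Hy], (family_total HT Hj) as [t Ht].
      destruct (HYT j y t Hy Ht) as (X & HX & HXy).
      destruct (compactification_point HZF Hw HX HXy) as [Hinf [oo Hoo]].
      exists oo; split; [eauto|]; intros oo' (y' & t' & Hy' & Ht' & Hoo').
      rewrite (family_unique HZF HY Hy' Hy), (family_unique HZF HT Ht' Ht)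
        in Hoo'.
      exact (point_at_infinity_unique HZF Hw Hinf Hoo Hoo'). }
    assert (Hoo : forall j oo y t, app o j oo -> app Y j y -> app T j t ->
              point_at_infinity y t oo).
    { intros j oo y t H Hy Ht; apply Hoj in H.
      destruct H as (_ & y' & t' & Hy' & Ht' & H).
      rewrite (family_unique HZF HY Hy' Hy), (family_unique HZF HT Ht' Ht) in H.
      auto. }
    destruct (Hfc o (infinity_in_product HZF HT HP Ho Hoo))
      as (B & HB & HBT & HBo & HBbase).
    destruct (countable_elim HZF Hw HJ) as (i & Hi & Hi_inj).
    destruct (countable_elim HZF Hw HB) as (b & Hb & Hb_inj).
    exact (product_metrizable HZF Hw HY HT HP HTP Ho Hoo Hi Hi_inj HBT HBo
             HBbase Hb Hb_inj R). }
  assert (Hqf : quasi_metrizable R P TP -> first_countable P TP).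
  { intros (d & Hd & Hind); exact (quasi_metric_first_countable HZF Hw Hd Hind). }
  assert (Hmq : metrizable R P TP -> quasi_metrizable R P TP).
  { intros (d & [Hd _] & Hind); exists d; auto. }
  tauto.
Qed.
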